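(* Let $d=1$, let $R$ be an integer with $|R|\ge2$, $B\subset\mathbb{Z}$ finite with $0\in B$, $N:=|B|$, such that $\mu=\mu(R,B)$ has no overlap. Let $L\subset\mathbb{Z}$ be finite with $0\in L$ and $(\alpha_l)_{l\in L}$ nonzero complex numbers with $\alpha_0=1$ such that the matrix $\frac{1}{\sqrt N}\left(e^{2\pi i lb/R}\alpha_l\right)_{l\in L,b\in B}$ has orthonormal columns. Assume that for all $l\in L$ with $l\neq0$, $$[l]\cap L\neq\{l'\in L: l'\equiv l\pmod R\}.$$ Then $\left\{\Big(\prod_{i=0}^k\alpha_{l_i}\Big)e_{l_0+Rl_1+\dots+R^kl_k}: l_0\dots l_k\in\Omega(L)\right\}$ is a Parseval frame for $L^2(\mu)$.
   Context: $\tau_b(x)=(x+b)/R$; $\mu(R,B)$ is the unique Borel probability measure with $\mu(E)=\frac1N\sum_b\mu(\tau_b^{-1}(E))$, supported on the attractor $X_B=\bigcup_b\tau_b(X_B)$; no overlap means $\mu(\tau_b(X_B)\cap\tau_{b'}(X_B))=0$ for $b\ne b'$. $e_\lambda(x)=e^{2\pi i\lambda x}$. For $k\in\mathbb{Z}$, $[k]=\{k'\in\mathbb{Z}:(k'-k)b/R\in\mathbb{Z}\ \forall b\in B\}$. $\Omega(L)$: the empty word (giving $e_0$ with weight 1) and all words $l_0\dots l_k$ with $l_i\in L$, $l_k\ne0$. Parseval frame: $\sum_i|\langle v,f_i\rangle|^2=\|v\|^2$ for all $v$. *)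

(* Defs.v *)
From HB Require Import structures.
From mathcomp Require Import all_boot all_order all_algebra.
From mathcomp Require Import all_classical all_reals all_analysis.
From mathcomp Require Import complex.
Set Implicit Arguments. Unset Strict Implicit. Unset Printing Implicit Defensive.
Import Order.TTheory GRing.Theory Num.Theory numFieldNormedType.Exports.
Local Open Scope classical_set_scope.
Local Open Scope ring_scope.

Section Defs.
Variable R : realType.

Definition cexp2pi (t : R) : R[i] := Complex (cos (2 * pi * t)) (sin (2 * pi * t)).

Definition e_ (lam : int) (x : R) : R[i] := cexp2pi (lam%:~R * x).

Definition sqnorm (z : R[i]) : R := complex.Re z ^+ 2 + complex.Im z ^+ 2.

Definition tau (Rs b : int) (x : R) : R := (x + b%:~R) / Rs%:~R.

Definition hadamard_entry (Rs : int) (N : nat) (alpha : int -> R[i]) (l b : int) : R[i] :=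
  Complex ((Num.sqrt (N%:R : R))^-1) 0 * cexp2pi ((l * b)%:~R / Rs%:~R) * alpha l.

Definition zclass (Rs : int) (B : seq int) (k : int) : set int :=
  [set k' | forall b, b \in B -> (Rs %| (k' - k) * b)%Z].

Definition Omega (L : seq int) : set (seq int) :=
  [set w | all (fun l => l \in L) w /\ (w = [::] \/ last 0 w <> 0)].

Definition word_freq (Rs : int) (w : seq int) : int :=
  \sum_(i < size w) nth 0 w i * Rs ^+ i.

Definition word_weight (alpha : int -> R[i]) (w : seq int) : R[i] :=
  \prod_(l <- w) alpha l.

Variable mu : probability R R.

Definition cintegral (h : R -> R[i]) : R[i] :=
  Complex (Rintegral mu setT (fun x => complex.Re (h x))) (Rintegral mu setT (fun x => complex.Im (h x))).

Definition cinner (f g : R -> R[i]) : R[i] := cintegral (fun x => f x * conjc (g x)).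

(* f is (a representative of) an element of L^2(mu) *)
Definition L2 (f : R -> R[i]) : Prop :=
  measurable_fun setT (fun x => complex.Re (f x)) /\ measurable_fun setT (fun x => complex.Im (f x)) /\
  (\int[mu]_x (sqnorm (f x))%:E < +oo)%E.

Definition parseval_frame (I : choiceType) (idx : set I) (g : I -> R -> R[i]) : Prop :=
  forall f, L2 f ->
    (\esum_(i in idx) (sqnorm (cinner f (g i)))%:E = \int[mu]_x (sqnorm (f x))%:E)%E.

End Defs.

(* Main.v *)
Require Import Defs.
From HB Require Import structures.
From mathcomp Require Import all_boot all_order all_algebra.
From mathcomp Require Import all_classical all_reals all_analysis.
From mathcomp Require Import measurable_realfun complex ring lra zify.
Import Order.TTheory GRing.Theory Num.Theory numFieldNormedType.Exports.
Local Open Scope classical_set_scope.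
Local Open Scope ring_scope.

(* Let [adj l f] be the adjoint of [f |-> alpha_l e_l (f o (R . ))].  Orthonormality
   of the columns and invariance of [mu] give [sum_l |adj l f|^2 = |f|^2], and the
   coefficient of [f] on the word [l w] is that of [adj l f] on [w]; hence Bessel's
   inequality, and the defect [|f|^2 - sum_w |<f, f_w>|^2] is a nonnegative quadratic
   form, continuous for the [L^2] norm.  It thus suffices that it vanishes on the
   exponentials [e_t], [t] real, whose span is dense.

   On [e_t] the partial sums are iterates of the transfer operator
   [h |-> sum_l p_l(t) h((t - l)/R)], [p_l(t) = |alpha_l m_B((t - l)/R)|^2], started at
   the square modulus [phi] of the Fourier transform of [mu].  As [phi] has finitely
   many zeros in a bounded interval, the zero sets of the iterates stabilise to a
   finite set invariant under the transitions of positive probability.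
   Multiplication by [R] modulo 1 is injective on such a set, so by the hypothesis on
   [l] only the digit 0 occurs and the set contains 0 if it is nonempty; but
   [phi 0 = 1].  So the iterates become bounded below by some [c > 0], and a
   comparison of harmonic functions upgrades this bound to the limit 1. *)

Set Implicit Arguments. Unset Strict Implicit. Unset Printing Implicit Defensive.

(** * Injectivity and sums on finite sequences *)

Lemma uniq_map_inj_in (T1 T2 : eqType) (f : T1 -> T2) (s : seq T1) :
  uniq (map f s) -> {in s &, injective f}.
Proof.
elim: s => [|a s IH] //= /andP[/negP fa us] x y.
rewrite !inE => /predU1P[->|xs] /predU1P[->|ys] // e; last exact: IH.
  by case: fa; rewrite e map_f.
by case: fa; rewrite -e map_f.
Qed.

Lemma ler_sum_term (R : numDomainType) (I : eqType) (s : seq I) (F : I -> R) i :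
  i \in s -> (forall j, j \in s -> 0 <= F j) -> F i <= \sum_(j <- s) F j.
Proof.
move=> si F0; rewrite (big_rem i)//= lerDl big_seq sumr_ge0// => j /mem_rem.
exact: F0.
Qed.

(** * Transfer operators and the convergence of their iterates to 1 *)

Section TransferOperator.
Variables (R : realType) (Rs : int) (L : seq int) (p : int -> R -> R).
Hypothesis Rs2 : (2 <= `|Rs|)%R.
Hypothesis p_ge0 : forall l t, l \in L -> 0 <= p l t.
Hypothesis p_sum : forall t, \sum_(l <- L) p l t = 1.

(** Inverse of [t |-> l + Rs * t], which is how prepending the digit [l] to a word acts on its
    frequency. *)
Definition inv_branch (l : int) (t : R) : R := (t - l%:~R) / Rs%:~R.
Local Notation g := inv_branch.

Let RsN0 : Rs%:~R != 0 :> R.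
Proof. by rewrite intr_eq0; apply/eqP => Rs0; move: Rs2; rewrite Rs0 normr0. Qed.

Let Rs2R : 2 <= `|Rs%:~R| :> R.
Proof. by rewrite -intr_norm (_ : 2 = 2%:~R)// ler_int. Qed.

Lemma exists_transition t : exists2 l, l \in L & 0 < p l t.
Proof.
apply: contrapT => nex; have := p_sum t.
rewrite big_seq big1 => [/esym/eqP|l lL]; first by rewrite oner_eq0.
apply/eqP; rewrite eq_le p_ge0// andbT leNgt; apply/negP => pl.
by apply: nex; exists l.
Qed.

Let frac (x : R) : R := x - (Num.floor x)%:~R.

Let fracD (x : R) (m : int) : frac (x + m%:~R) = frac x.
Proof. by rewrite /frac floorDrz ?intr_int// intrKfloor intrD; ring. Qed.

(* Multiplication by [Rs] maps the classes modulo 1 of [F] onto a set containing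
   them, so it is injective on these classes: a point of [F] cannot have two
   successors that differ modulo 1, and only the digit 0 is ever used. *)
Lemma finite_invariant_set_has0 (F : seq R) :
  (forall t l, l \in L -> l != 0 -> 0 < p l t ->
     exists l', [/\ l' \in L, 0 < p l' t & ~~ (Rs %| l' - l)%Z]) ->
  (forall t l, t \in F -> l \in L -> 0 < p l t -> g l t \in F) ->
  F != [::] -> 0 \in F.
Proof.
move=> branch inv F0.
pose f c := frac (Rs%:~R * c).
have ffrac s : f (frac s) = frac (Rs%:~R * s).
  rewrite -(fracD (Rs%:~R * s) (- (Rs * Num.floor s))) /f; congr frac.
  by rewrite /frac intrN intrM; ring.
have fg l t : f (frac (g l t)) = frac t.
  rewrite ffrac -(fracD t (- l)); congr frac.
  by rewrite /g intrN mulrC divfK.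
pose C := undup (map frac F).
have subC : {subset C <= map f C}.
  move=> c; rewrite mem_undup => /mapP[t tF ->].
  have [l lL pl] := exists_transition t.
  by rewrite -(fg l t) map_f// mem_undup map_f// inv.
have fC : {in C &, injective f}.
  apply: uniq_map_inj_in; apply: leq_size_uniq subC _; first exact: undup_uniq.
  by rewrite size_map.
have only0 t l : t \in F -> l \in L -> 0 < p l t -> l = 0.
  move=> tF lL pl; apply/eqP/negPn/negP => l0.
  have [l' [l'L pl' /negP ndvd]] := branch _ _ lL l0 pl; apply: ndvd.
  have : frac (g l t) = frac (g l' t).
    by apply: fC; rewrite ?mem_undup ?map_f ?inv// !fg.
  rewrite /frac => e; apply/dvdzP; exists (Num.floor (g l t) - Num.floor (g l' t)).
  apply: (@intr_inj R); rewrite intrM !intrB.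
  have -> : (Num.floor (g l t))%:~R - (Num.floor (g l' t))%:~R = g l t - g l' t.
    by lra.
  by rewrite /g -mulrBl divfK//; ring.
have stab t : t \in F -> t / Rs%:~R \in F.
  move=> tF; have [l lL pl] := exists_transition t.
  have l0 := only0 _ _ tF lL pl.
  by have := inv _ _ tF lL pl; rewrite /g l0 subr0.
(* division by [Rs] permutes [undup F], hence preserves the sum of absolute values *)
have perm : perm_eq (map (fun t => t / Rs%:~R) (undup F)) (undup F).
  have u : uniq (map (fun t => t / Rs%:~R) (undup F)).
    by rewrite map_inj_uniq ?undup_uniq//; apply: mulIf; rewrite invr_eq0.
  apply: uniq_perm => //; first exact: undup_uniq.
  have sub : {subset map (fun t => t / Rs%:~R) (undup F) <= undup F}.
    by move=> x /mapP[t]; rewrite !mem_undup => tF ->; rewrite stab.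
  by have [|_] := uniq_min_size u sub; first by rewrite size_map.
(* Division by [Rs] also divides this sum by [|Rs| >= 2], so the sum is 0. *)
have sum0 : \sum_(t <- undup F) `|t| = 0.
  have := perm_big _ perm (F := fun t : R => `|t|) (op := +%R) (x := 0) (P := xpredT).
  rewrite big_map; under eq_bigr do rewrite normrM normfV.
  rewrite -mulr_suml; set S := \sum_(_ <- _) _ => e.
  have aN0 : `|Rs%:~R| != 0 :> R by rewrite normr_eq0.
  have /eqP : S * (`|Rs%:~R| - 1) = 0 by rewrite mulrBr mulr1 -{1}e divfK ?subrr.
  rewrite mulf_eq0 => /orP[/eqP//|/eqP R1].
  by move: Rs2R R1; lra.
case: F F0 {inv subC fC only0 perm} @C sum0 stab => // t F _ _ sum0 _.
suff /eqP <- : t == 0 by rewrite mem_head.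
rewrite -normr_le0 -sum0.
by apply: (ler_sum_term (F := fun t : R => `|t|)) => //; rewrite mem_undup mem_head.
Qed.

Variable phi : R -> R.
Hypothesis phi_ge0 : forall t, 0 <= phi t.
Hypothesis phi_le1 : forall t, phi t <= 1.
Hypothesis phi0 : phi 0 = 1.
Hypothesis phi_cont : continuous phi.
Hypothesis p_cont : forall l, continuous (p l).
Hypothesis L0 : 0 \in L.
Hypothesis phi_rec : forall t, phi t = p 0 t * phi (t / Rs%:~R).

(** Expected value of [phi] after [n] steps of the walk that goes from [t] to [g l t] with
    probability [p l t]. *)
Fixpoint transfer_iter (n : nat) (t : R) : R :=
  if n is n'.+1 then \sum_(l <- L) p l t * transfer_iter n' (g l t) else phi t.
Local Notation h := transfer_iter.

Let g0 t : g 0 t = t / Rs%:~R. Proof. by rewrite /g subr0. Qed.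

Lemma transfer_iter_ge0 n t : 0 <= h n t.
Proof.
elim: n t => [//|n IH] t /=; rewrite big_seq sumr_ge0// => l lL.
by rewrite mulr_ge0// p_ge0.
Qed.

Lemma transfer_iter_le1 n t : h n t <= 1.
Proof.
elim: n t => [//|n IH] t /=; rewrite -(p_sum t) big_seq [leRHS]big_seq.
by apply: ler_sum => l lL; rewrite ler_piMr// p_ge0.
Qed.

(** By [phi_rec], [phi] is the digit 0 term of its own transfer, whose other terms are nonnegative;
    the operator preserves order. *)
Lemma transfer_iterS n t : h n t <= h n.+1 t.
Proof.
elim: n t => [|n IH] t /=.
  rewrite {1}phi_rec -g0.
  apply: (ler_sum_term (F := fun l => p l t * phi (g l t))) => // l lL.
  by rewrite mulr_ge0// p_ge0.
rewrite big_seq [leRHS]big_seq; apply: ler_sum => l lL.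
by rewrite ler_wpM2l ?p_ge0.
Qed.

Lemma transfer_iter_homo t : {homo h ^~ t : m n / (m <= n)%N >-> m <= n}.
Proof. by apply/nondecreasing_seqP => n; exact: transfer_iterS. Qed.

Lemma continuous_inv_branch l : continuous (g l).
Proof. by move=> t; apply: cvgMl; apply: cvgB; [exact: cvg_id|exact: cvg_cst]. Qed.

Lemma continuous_transfer_iter n : continuous (h n).
Proof.
elim: n => [//|n IH] t /=; apply: cvg_big => [|l _]; first exact: add_continuous.
  apply: cvgM; first exact: p_cont.
by apply: continuous_comp; [exact: continuous_inv_branch|exact: IH].
Qed.


Hypothesis branch : forall t l, l \in L -> l != 0 -> 0 < p l t ->
  exists l', [/\ l' \in L, 0 < p l' t & ~~ (Rs %| l' - l)%Z].
Hypothesis finite_zeros : forall K : R, exists s : seq R,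
  forall t, `|t| <= K -> phi t = 0 -> t \in s.

Section BoundedInterval.
Variable K : R.
Hypothesis LK : forall l, l \in L -> `|l%:~R| <= K :> R.

(** Since [|Rs| >= 2], the value is at most [(K + K) / 2]. *)
Lemma inv_branch_bound l t : l \in L -> `|t| <= K -> `|g l t| <= K.
Proof.
move=> lL tK; rewrite /g normrM normfV ler_pdivrMr; last by move: Rs2R; lra.
have : `|t - l%:~R| <= `|t| + `|l%:~R| := ler_normB _ _.
have : 0 <= K * (`|Rs%:~R| - 2).
  by rewrite mulr_ge0 ?subr_ge0//; exact: le_trans tK.
by have := LK lL; lra.
Qed.

(** The zero sets [Z n] are finite and decrease, so two consecutive ones agree. A zero of the sum
    [h n.+1] makes [h n] vanish at every successor of positive probability, so this common set is
    invariant; it cannot contain 0, hence is empty. *)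
Lemma transfer_iter_gt0 : exists n, forall t, `|t| <= K -> 0 < h n t.
Proof.
have [s hs] := finite_zeros K.
pose Z n := [seq t <- s | (`|t| <= K) && (h n t == 0)].
have h0S n t : h n.+1 t = 0 -> h n t = 0.
  by move=> e; apply/eqP; rewrite eq_le transfer_iter_ge0 andbT -e transfer_iterS.
have phi_h n t : phi t <= h n t by exact: (transfer_iter_homo t (leq0n n)).
have ZS n : Z n.+1 = [seq t <- Z n | h n.+1 t == 0].
  rewrite -filter_predI; apply: eq_filter => t /=.
  case: (altP (h n.+1 t =P 0)) => [/h0S ->|_]; last by rewrite andbF.
  by rewrite eqxx andbT.
(* Otherwise the sizes of the [Z n] would decrease strictly for ever. *)
have [n hn] : exists n, (size (Z n) <= size (Z n.+1))%N.
  apply: contrapT => nex.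
  have dec n : (size (Z n) + n <= size (Z 0))%N.
    elim: n => [|n IH]; first by rewrite addn0.
    have : (size (Z n.+1) < size (Z n))%N.
      by rewrite ltnNge; apply/negP => le; apply: nex; exists n.
    by move: IH; lia.
  by have := dec (size (Z 0)).+1; rewrite addnS leqNgt ltnS leq_addl.
have ZP t : t \in Z n -> h n.+1 t = 0.
  have : all (fun t => h n.+1 t == 0) (Z n).
    by rewrite all_count eqn_leq count_size/= -size_filter -ZS.
  by move=> /allP/[apply]/eqP.
have ZI t : `|t| <= K -> h n t = 0 -> t \in Z n.
  move=> tK hnt; rewrite mem_filter tK hnt eqxx/=; apply: hs => //.
  by apply/eqP; rewrite eq_le phi_ge0 andbT -hnt.
have Znil : Z n = [::].
  apply/eqP/negPn/negP => Zn0.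
  have /ZP h0 : 0 \in Z n.
    apply: finite_invariant_set_has0 Zn0 => // t l tZ lL pl.
    have tK : `|t| <= K by move: tZ; rewrite mem_filter => /andP[/andP[]].
    apply: ZI; first exact: inv_branch_bound.
    have : p l t * h n (g l t) <= 0.
      rewrite -(ZP _ tZ) /=.
      apply: (ler_sum_term (F := fun l => p l t * h n (g l t))) => // j jL.
      by rewrite mulr_ge0 ?p_ge0// transfer_iter_ge0.
    rewrite pmulr_rle0// => hg; apply/eqP.
    by rewrite eq_le hg transfer_iter_ge0.
  by have := phi_h n.+1 0; rewrite phi0 h0 ler10.
exists n => t tK; rewrite lt_neqAle transfer_iter_ge0 andbT eq_sym.
by apply/eqP => /(ZI _ tK); rewrite Znil.
Qed.

Let hinf t := limn (h ^~ t).

Let cvg_hinf t : h ^~ t @ \oo --> hinf t.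
Proof.
apply: nondecreasing_is_cvgn; first exact: transfer_iter_homo.
by exists 1 => _ [n _ <-]; exact: transfer_iter_le1.
Qed.

Let h_le_hinf n t : h n t <= hinf t.
Proof.
apply: nondecreasing_cvgn_le; first exact: transfer_iter_homo.
exact: cvg_hinf.
Qed.

Let hinf_harmonic t : hinf t = \sum_(l <- L) p l t * hinf (g l t).
Proof.
apply: (@cvg_unique _ (@norm_hausdorff _ R^o) (h n.+1 t @[n --> \oo])).
  by have := @cvg_hinf t; rewrite -(cvg_shiftS (h ^~ t)).
apply: cvg_big => [|l _]; first exact: add_continuous.
by apply: cvgM; [exact: cvg_cst|exact: cvg_hinf].
Qed.

(* With [c] a positive lower bound of the limit [H], the nonnegative harmonic
   function [H - c] dominates [(1 - c) * phi] near 0, hence everywhere along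
   [t / Rs ^ k], and therefore dominates [(1 - c) * H]. *)
Lemma transfer_limit_ge1 t : `|t| <= K -> 1 <= hinf t.
Proof.
move=> tK; have K0 : 0 <= K by apply: le_trans tK.
(* [c] is the minimum over [[-K, K]] of a positive continuous [h n], and the iterates increase to
   the limit. *)
have [c c0 hc] : exists2 c, 0 < c & forall t, `|t| <= K -> c <= hinf t.
  have [n hn] := transfer_iter_gt0.
  have [] := @EVT_min _ (h n) (- K) K; first by lra.
    by apply: continuous_subspaceT; exact: continuous_transfer_iter.
  move=> x; rewrite in_itv/= -ler_norml => xK hx; exists (h n x); first exact: hn.
  move=> y yK; apply: le_trans (h_le_hinf n y); apply: hx.
  by rewrite in_itv/= -ler_norml.
pose w t := hinf t - c.
have w_harmonic u : w u = \sum_(l <- L) p l u * w (g l u).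
  rewrite /w {1}hinf_harmonic -[c in LHS]mul1r -(p_sum u) mulr_suml -sumrB.
  by apply: eq_bigr => l _; rewrite mulrBr.
have w_ge0 u : `|u| <= K -> 0 <= w u by move=> uK; rewrite subr_ge0 hc.
rewrite leNgt; apply/negP => H1.
(* The aim is [a * hinf t <= w t], that is [c * (1 - hinf t) <= eps * hinf t <= eps], whereas the
   left side is [2 * eps] by this choice. *)
pose eps := c * (1 - hinf t) / 2.
have eps0 : 0 < eps by rewrite /eps divr_gt0// mulr_gt0// subr_gt0.
pose a := 1 - c - eps.
have [d d0 hd] : exists2 d, 0 < d & forall u, `|u| < d -> 1 - eps <= phi u.
  have /cvgrPdist_le/(_ _ eps0) := @phi_cont 0.
  rewrite phi0 => -[d /= d0 hd]; exists d => // u ud.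
  have : `|1 - phi u| <= eps by apply: hd; rewrite /= sub0r normrN.
  by rewrite ler_distl; lra.
(* Near 0, [hinf >= phi >= 1 - eps] gives [w >= a]; a negative [a] is trivial. To double the radius,
   keep only the digit 0 term of [w_harmonic] and compare it with [phi_rec]. *)
have phi_w k u : `|u| < d * 2 ^+ k -> `|u| <= K -> a * phi u <= w u.
  elim: k u => [|k IH] u.
    rewrite expr0 mulr1 => ud uK.
    have [a0|a0] := leP 0 a.
      rewrite (le_trans (ler_piMr a0 (phi_le1 u)))//.
      by have := h_le_hinf 0 u; have := hd _ ud; rewrite /= /a /w; lra.
    rewrite (le_trans _ (w_ge0 _ uK))// mulr_le0_ge0//; exact: ltW.
  move=> ud uK.
  have uRs : `|u / Rs%:~R| < d * 2 ^+ k.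
    rewrite normrM normfV ltr_pdivrMr; last by move: Rs2R; lra.
    apply: (lt_le_trans ud); rewrite exprSr mulrA ler_wpM2l//.
    by rewrite mulr_ge0 ?exprn_ge0// ltW.
  have uRsK : `|u / Rs%:~R| <= K by rewrite -g0 inv_branch_bound.
  rewrite phi_rec mulrCA.
  apply: (@le_trans _ _ (p 0 u * w (g 0 u))).
    by rewrite ler_wpM2l ?p_ge0// g0 IH.
  rewrite (w_harmonic u).
  apply: (ler_sum_term (F := fun l => p l u * w (g l u))) => // l lL.
  by rewrite mulr_ge0 ?p_ge0// w_ge0// inv_branch_bound.
(* The comparison with [phi] passes to its iterates because [w] is harmonic and the operator
   preserves order. *)
have h_w n u : `|u| <= K -> a * h n u <= w u.
  elim: n u => [|n IH] u uK /=.
    have [k hk] : exists k, `|u| < d * 2 ^+ k.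
      exists (Num.truncn (`|u| / d)).+1; rewrite mulrC -ltr_pdivrMr//.
      apply: lt_le_trans (truncnS_gt _) _.
      by rewrite -natrX ler_nat ltnW// ltn_expl.
    exact: phi_w hk uK.
  rewrite (w_harmonic u) mulr_sumr big_seq [leRHS]big_seq; apply: ler_sum => l lL.
  by rewrite mulrCA ler_wpM2l ?p_ge0// IH// inv_branch_bound.
have aw : a * hinf t <= w t.
  have cv : a * h n t @[n --> \oo] --> a * hinf t.
    by apply: cvgM; [exact: cvg_cst|exact: cvg_hinf].
  rewrite -(cvg_lim _ cv)//; apply: limr_le; first by apply/cvg_ex; exists (a * hinf t).
  by apply: nearW => n; exact: h_w.
have epsH : eps * hinf t <= eps by rewrite ler_piMr// ltW.
have : c * (1 - hinf t) = 2 * eps by rewrite /eps; lra.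
by move: aw; rewrite /a /w; lra.
Qed.

End BoundedInterval.

Theorem transfer_iter_cvg1 t eps : 0 < eps -> exists n, 1 - eps <= h n t.
Proof.
(* This [K] bounds the starting point and every digit, so [[-K, K]] is stable under all branches. *)
move=> eps0; pose K := `|t| + \sum_(l <- L) `|l%:~R|.
have LK l : l \in L -> `|l%:~R| <= K :> R.
  move=> lL; rewrite ler_wpDl//.
  exact: (ler_sum_term (F := fun l : int => `|l%:~R| : R)).
have tK : `|t| <= K by rewrite lerDl sumr_ge0.
have H1 := transfer_limit_ge1 LK tK.
have cv : h ^~ t @ \oo --> limn (h ^~ t).
  apply: nondecreasing_is_cvgn; first exact: transfer_iter_homo.
  by exists 1 => _ [n _ <-]; exact: transfer_iter_le1.
have [|N _ /(_ N (leqnn N)) hN] := cvgr_ge _ cv (1 - eps); last by exists N.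
by apply: lt_le_trans H1; rewrite ltrBlDr ltrDl.
Qed.

End TransferOperator.

(** * Square moduli and exponentials of complex numbers *)

Section ComplexNumbers.
Variable R : realType.
Implicit Types (z w : R[i]) (s t : R).
Local Notation Re := (@complex.Re R).
Local Notation Im := (@complex.Im R).

Lemma complex_eq z w : Re z = Re w -> Im z = Im w -> z = w.
Proof. by case: z w => a b [c d] /= -> ->. Qed.

Lemma cReD z w : Re (z + w) = Re z + Re w. Proof. by case: z w => a b []. Qed.
Lemma cImD z w : Im (z + w) = Im z + Im w. Proof. by case: z w => a b []. Qed.
Lemma cReM z w : Re (z * w) = Re z * Re w - Im z * Im w.
Proof. by case: z w => a b []. Qed.
Lemma cImM z w : Im (z * w) = Re z * Im w + Im z * Re w.
Proof. by case: z w => a b []. Qed.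
Lemma cReC z : Re (conjc z) = Re z. Proof. by case: z. Qed.
Lemma cImC z : Im (conjc z) = - Im z. Proof. by case: z. Qed.

Lemma conjcM z w : conjc (z * w) = conjc z * conjc w.
Proof. exact: rmorphM. Qed.

Lemma sqnorm_ge0 z : 0 <= sqnorm z.
Proof. by rewrite addr_ge0 ?sqr_ge0. Qed.

Lemma sqnormM z w : sqnorm (z * w) = sqnorm z * sqnorm w.
Proof. by rewrite /sqnorm cReM cImM; ring. Qed.

Lemma sqnormJ z : sqnorm (conjc z) = sqnorm z.
Proof. by rewrite /sqnorm cReC cImC sqrrN. Qed.

Lemma sqnorm1 : sqnorm (1 : R[i]) = 1.
Proof. by rewrite /sqnorm /= expr1n expr0n addr0. Qed.

Lemma sqnorm_eq0 z : (sqnorm z == 0) = (z == 0).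
Proof.
case: z => a b; rewrite /sqnorm /= paddr_eq0 ?sqr_ge0// !sqrf_eq0.
by rewrite eq_complex.
Qed.

Lemma sqnorm_gt0 z : (0 < sqnorm z) = (z != 0).
Proof. by rewrite lt_neqAle sqnorm_ge0 andbT eq_sym sqnorm_eq0. Qed.

Lemma sqnorm_parallelogram z w :
  sqnorm (z + w) + sqnorm (z - w) = 2 * sqnorm z + 2 * sqnorm w.
Proof. by case: z w => a b [c d]; rewrite /sqnorm /=; ring. Qed.

Lemma sqnormD_le z w : sqnorm (z + w) <= 2 * sqnorm z + 2 * sqnorm w.
Proof. by rewrite -sqnorm_parallelogram lerDl sqnorm_ge0. Qed.

Lemma sqnormE z : (sqnorm z)%:C%C = z * conjc z.
Proof. by case: z => a b; apply: complex_eq; rewrite /sqnorm /=; ring. Qed.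

(** From [(|Re z| - 1)^2 >= 0]; this makes square integrable functions integrable for a
    probability. *)
Lemma Re_le_sqnorm z : `|Re z| <= 1 + sqnorm z.
Proof.
rewrite /sqnorm; have := sqr_ge0 (Im z); have := sqr_ge0 (`|Re z| - 1).
by rewrite sqrrB real_normK ?num_real// expr1n; have := normr_ge0 (Re z); nra.
Qed.

Lemma Im_le_sqnorm z : `|Im z| <= 1 + sqnorm z.
Proof.
rewrite /sqnorm; have := sqr_ge0 (Re z); have := sqr_ge0 (`|Im z| - 1).
by rewrite sqrrB real_normK ?num_real// expr1n; have := normr_ge0 (Im z); nra.
Qed.

Lemma cexp2piD s t : cexp2pi (s + t) = cexp2pi s * cexp2pi t.
Proof.
by apply: complex_eq; rewrite /cexp2pi /= mulrDr ?cosD ?sinD//; ring.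
Qed.

Lemma cexp2pi0 : cexp2pi (0 : R) = 1.
Proof. by rewrite /cexp2pi mulr0 cos0 sin0. Qed.

Lemma conjc_cexp2pi t : conjc (cexp2pi t) = cexp2pi (- t).
Proof. by rewrite /cexp2pi /= mulrN cosN sinN. Qed.

Lemma cexp2piN t : cexp2pi t * cexp2pi (- t) = 1.
Proof. by rewrite -cexp2piD subrr cexp2pi0. Qed.

Lemma sqnorm_cexp2pi t : sqnorm (cexp2pi t) = 1.
Proof. by rewrite /sqnorm /= cos2Dsin2. Qed.

Lemma cexp2pi_int (m : int) : cexp2pi (m%:~R : R) = 1.
Proof.
have nat1 (n : nat) : cexp2pi (n%:R : R) = 1.
  elim: n => [|n IH]; first exact: cexp2pi0.
  rewrite -natr1 cexp2piD IH mul1r /cexp2pi mulr1 [2 * pi]mulr_natl.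
  by rewrite cos2pi sin2pi.
case: m => n; first exact: nat1.
by rewrite NegzE intrN -conjc_cexp2pi nat1 conjc1.
Qed.

Lemma cexp2piDz t (m : int) : cexp2pi (t + m%:~R) = cexp2pi t.
Proof. by rewrite cexp2piD cexp2pi_int mulr1. Qed.

(** For [0 < |s - t| < 1] the number [sin (pi * |s - t|)] is positive, so the double angle formula
    gives [cos (2 * pi * |s - t|) < 1]. *)
Lemma cexp2pi_inj s t : `|s - t| < 1 -> cexp2pi s = cexp2pi t -> s = t.
Proof.
move=> st e; apply/eqP; rewrite -subr_eq0; apply/negPn/negP => d0.
have e1 : cexp2pi (s - t) = 1 by rewrite cexp2piD e cexp2piN.
have e2 : cexp2pi `|s - t| = 1.
  have [_|_] := ger0P (s - t); first by [].
  by rewrite -conjc_cexp2pi e1 conjc1.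
have s0 : 0 < sin (pi * `|s - t|).
  apply: sin_gt0_pi; have := @pi_gt0 R => pi0.
  by rewrite mulr_gt0 ?normr_gt0//= gtr_pMr.
have : cos (2 * pi * `|s - t|) = 1 by case: e2.
rewrite -mulrA mulr_natl cos_mulr2n cos2sin2 => e3.
have : 0 < sin (pi * `|s - t|) ^+ 2 by rewrite exprn_gt0.
by move: e3; rewrite mulr2n; lra.
Qed.

(** Expand the square moduli and sum over [l] first: orthonormality of the columns kills the terms
    with [b != b']. *)
Lemma sqnorm_sum_conj (I J : eqType) (s : seq I) (r : seq J) (M : I -> J -> R[i])
    (v : J -> R[i]) : uniq r ->
  (forall b b', b \in r -> b' \in r ->
     \sum_(l <- s) M l b * conjc (M l b') = (b == b')%:R) ->
  \sum_(l <- s) sqnorm (\sum_(b <- r) conjc (M l b) * v b) =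
  \sum_(b <- r) sqnorm (v b).
Proof.
move=> ur orth; apply: complexI; rewrite !rmorph_sum /=.
transitivity (\sum_(l <- s) \sum_(b <- r) \sum_(b' <- r)
    v b * conjc (v b') * (M l b' * conjc (M l b))).
  apply: eq_bigr => l _; rewrite sqnormE rmorph_sum mulr_suml.
  apply: eq_bigr => b _; rewrite mulr_sumr; apply: eq_bigr => b' _.
  by rewrite rmorphM /= conjcK; ring.
rewrite exchange_big; apply: eq_big_seq => b br /=.
rewrite exchange_big /=.
under eq_big_seq => b' b'r do rewrite -mulr_sumr orth//.
rewrite (bigD1_seq b)//= eqxx mulr1 big1_seq ?addr0 ?sqnormE// => b' /andP[b'b _].
by rewrite (negbTE b'b) mulr0.
Qed.

End ComplexNumbers.

(** * Complex integrals and the space [L^2(mu)] *)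

Section ComplexIntegration.
Variables (R : realType) (mu : probability R R).
Implicit Types (f g : R -> R[i]) (u : R -> R).
Local Notation Re := (@complex.Re R).
Local Notation Im := (@complex.Im R).

Definition cmeasurable f :=
  measurable_fun setT (fun x => Re (f x)) /\ measurable_fun setT (fun x => Im (f x)).

Definition cintegrable f :=
  mu.-integrable setT (EFin \o (fun x => Re (f x))) /\
  mu.-integrable setT (EFin \o (fun x => Im (f x))).

(** The squared norm as a real number; [Rintegral] turns an infinite integral into 0, so it is
    meaningful only under [L2 mu f]. *)
Definition norm2 f : R := Rintegral mu setT (fun x => sqnorm (f x)).

Lemma cmeasurableD f g : cmeasurable f -> cmeasurable g -> cmeasurable (fun x => f x + g x).
Proof.
move=> [mf1 mf2] [mg1 mg2]; split.
  by under eq_fun do rewrite cReD; exact: measurable_funD.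
by under eq_fun do rewrite cImD; exact: measurable_funD.
Qed.

Lemma cmeasurableM f g : cmeasurable f -> cmeasurable g -> cmeasurable (fun x => f x * g x).
Proof.
move=> [mf1 mf2] [mg1 mg2]; split.
  by under eq_fun do rewrite cReM; apply: measurable_funB; exact: measurable_funM.
by under eq_fun do rewrite cImM; apply: measurable_funD; exact: measurable_funM.
Qed.

Lemma cmeasurableJ f : cmeasurable f -> cmeasurable (fun x => conjc (f x)).
Proof.
move=> [mf1 mf2]; split; first by under eq_fun do rewrite cReC.
by under eq_fun do rewrite cImC; exact: measurable_funN.
Qed.

Lemma cmeasurable_cst (c : R[i]) : cmeasurable (fun=> c).
Proof. by split; exact: measurable_cst. Qed.

Lemma cmeasurable_real u : measurable_fun setT u -> cmeasurable (fun x => (u x)%:C%C).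
Proof. by split => //=; exact: measurable_cst. Qed.

Lemma cmeasurable_comp f u :
  cmeasurable f -> measurable_fun setT u -> cmeasurable (fun x => f (u x)).
Proof.
move=> [mf1 mf2] mU; split; first exact: measurableT_comp mf1 mU.
exact: measurableT_comp mf2 mU.
Qed.

Lemma measurable_tau (Rs b : int) : measurable_fun setT (@tau R Rs b).
Proof. by apply: measurable_funM => //; exact: measurable_funD. Qed.

Lemma cmeasurable_cexp2pi : cmeasurable (@cexp2pi R).
Proof.
have m2pi : measurable_fun setT (fun x : R => 2 * pi * x) by exact: measurable_funM.
split; apply: (measurableT_comp _ m2pi).
  by apply: continuous_measurable_fun; exact: continuous_cos.
by apply: continuous_measurable_fun; exact: continuous_sin.
Qed.

Lemma measurable_sqnorm f : cmeasurable f -> measurable_fun setT (fun x => sqnorm (f x)).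
Proof. by move=> [mf1 mf2]; apply: measurable_funD; exact: measurable_funX. Qed.

Lemma L2_measurable f : L2 mu f -> cmeasurable f.
Proof. by move=> [? []]. Qed.

Lemma L2_integrable f : L2 mu f -> mu.-integrable setT (EFin \o (fun x => sqnorm (f x))).
Proof.
move=> fL2; have [_ [_ fi]] := fL2; apply/integrableP; split.
  by apply/measurable_EFinP; exact: measurable_sqnorm (L2_measurable fL2).
by under eq_integral do rewrite /= ger0_norm ?sqnorm_ge0//.
Qed.

Lemma norm2E f : L2 mu f -> (\int[mu]_x (sqnorm (f x))%:E)%E = (norm2 f)%:E.
Proof.
move=> fL2; rewrite /norm2 /Rintegral fineK//.
by apply: integrable_fin_num => //; exact: L2_integrable.
Qed.

Lemma norm2_ge0 f : 0 <= norm2 f.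
Proof. by apply: Rintegral_ge0 => x _; exact: sqnorm_ge0. Qed.

Lemma L2_dominated f (v : R -> R) : cmeasurable f ->
  mu.-integrable setT (EFin \o v) -> (forall x, sqnorm (f x) <= v x) -> L2 mu f.
Proof.
move=> mf iv fv; have [mf1 mf2] := mf; split => //; split => //.
have : mu.-integrable setT (EFin \o (fun x => sqnorm (f x))).
  apply: le_integrable iv => //; first by apply/measurable_EFinP; exact: measurable_sqnorm.
  move=> x _ /=; rewrite lee_fin ger0_norm ?sqnorm_ge0//.
  by rewrite (le_trans (fv x))// ler_norm.
move/integrableP => [_]; under eq_integral do rewrite /= ger0_norm ?sqnorm_ge0//.
by [].
Qed.

Lemma integrable_cst (k : R) : mu.-integrable setT (EFin \o (fun=> k)).
Proof. exact: finite_measure_integrable_cst. Qed.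

Lemma L2_bounded f (k : R) : cmeasurable f -> (forall x, sqnorm (f x) <= k) -> L2 mu f.
Proof. by move=> mf fk; exact: L2_dominated mf (integrable_cst k) fk. Qed.

Lemma L2D f g : L2 mu f -> L2 mu g -> L2 mu (fun x => f x + g x).
Proof.
move=> fL gL.
apply: (@L2_dominated _ (fun x => 2 * sqnorm (f x) + 2 * sqnorm (g x))).
- by apply: cmeasurableD; exact: L2_measurable.
- have := integrableD measurableT (integrableZl measurableT 2 (L2_integrable fL))
    (integrableZl measurableT 2 (L2_integrable gL)).
  by [].
- by move=> x; exact: sqnormD_le.
Qed.

Lemma L2M f g (k : R) : cmeasurable g -> (forall x, sqnorm (g x) <= k) ->
  L2 mu f -> L2 mu (fun x => g x * f x).
Proof.
move=> mg gk fL; apply: (@L2_dominated _ (fun x => k * sqnorm (f x))).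
- by apply: cmeasurableM => //; exact: L2_measurable.
- exact: (integrableZl measurableT k (L2_integrable fL)).
- by move=> x; rewrite sqnormM ler_wpM2r ?sqnorm_ge0.
Qed.

Lemma L2Z f (c : R[i]) : L2 mu f -> L2 mu (fun x => c * f x).
Proof. by apply: (@L2M _ _ (sqnorm c)); first exact: cmeasurable_cst. Qed.

Lemma L2B f g : L2 mu f -> L2 mu g -> L2 mu (fun x => f x - g x).
Proof.
move=> fL gL; under eq_fun => x do rewrite -[- g x]mulN1r.
by apply: L2D => //; exact: L2Z.
Qed.

Lemma L2_cst (c : R[i]) : L2 mu (fun=> c).
Proof. by apply: (@L2_bounded _ (sqnorm c)) => //; exact: cmeasurable_cst. Qed.

Lemma L2_sum (I : eqType) (s : seq I) (f : I -> R -> R[i]) :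
  (forall i, i \in s -> L2 mu (f i)) -> L2 mu (fun x => \sum_(i <- s) f i x).
Proof.
elim: s => [|i s IH] fL.
  by under eq_fun do rewrite big_nil; exact: L2_cst.
under eq_fun do rewrite big_cons.
apply: L2D; first by apply: fL; rewrite mem_head.
by apply: IH => j js; apply: fL; rewrite in_cons js orbT.
Qed.

Lemma L2_cintegrable f : L2 mu f -> cintegrable f.
Proof.
move=> fL; have [mf1 mf2] := L2_measurable fL.
have i1 := integrableD measurableT (integrable_cst 1) (L2_integrable fL).
split; apply: le_integrable i1 => //; try exact/measurable_EFinP.
  move=> x _ /=; rewrite lee_fin [leRHS]ger0_norm ?Re_le_sqnorm//.
  by rewrite addr_ge0// sqnorm_ge0.
move=> x _ /=; rewrite lee_fin [leRHS]ger0_norm ?Im_le_sqnorm//.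
by rewrite addr_ge0// sqnorm_ge0.
Qed.

Lemma cintegralD f g : cintegrable f -> cintegrable g ->
  cintegral mu (fun x => f x + g x) = cintegral mu f + cintegral mu g.
Proof.
move=> [f1 f2] [g1 g2]; apply: complex_eq; rewrite ?cReD ?cImD /=.
  by under eq_Rintegral do rewrite cReD; rewrite RintegralD.
by under eq_Rintegral do rewrite cImD; rewrite RintegralD.
Qed.

Lemma cintegralZ f (c : R[i]) : cintegrable f ->
  cintegral mu (fun x => c * f x) = c * cintegral mu f.
Proof.
have iZ (k : R) u : mu.-integrable setT (EFin \o u) ->
    mu.-integrable setT (EFin \o (fun x => k * u x)).
  by move=> iu; exact: (integrableZl measurableT k iu).
move=> [f1 f2]; apply: complex_eq; rewrite ?cReM ?cImM /=.
  under eq_Rintegral do rewrite cReM.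
  by rewrite RintegralB ?RintegralZl//; exact: iZ.
under eq_Rintegral do rewrite cImM.
by rewrite RintegralD ?RintegralZl//; exact: iZ.
Qed.

Lemma cintegral_sum (I : eqType) (s : seq I) (f : I -> R -> R[i]) :
  (forall i, i \in s -> L2 mu (f i)) ->
  cintegral mu (fun x => \sum_(i <- s) f i x) = \sum_(i <- s) cintegral mu (f i).
Proof.
elim: s => [|i s IH] fL.
  rewrite big_nil; under eq_fun do rewrite big_nil.
  by apply: complex_eq => /=; rewrite Rintegral_cst//= mul0r.
have fs j : j \in s -> L2 mu (f j) by move=> js; apply: fL; rewrite in_cons js orbT.
rewrite big_cons -IH// -cintegralD; last 2 first.
- by apply: L2_cintegrable; apply: fL; rewrite mem_head.
- by apply: L2_cintegrable; exact: L2_sum.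
by congr cintegral; apply/funext => x; rewrite big_cons.
Qed.

Lemma cintegral_cst (c : R[i]) : cintegral mu (fun=> c) = c.
Proof.
by apply: complex_eq; rewrite /= Rintegral_cst//= probability_setT mulr1.
Qed.

Lemma norm2_parallelogram f g : L2 mu f -> L2 mu g ->
  norm2 (fun x => f x + g x) + norm2 (fun x => f x - g x) = 2 * norm2 f + 2 * norm2 g.
Proof.
move=> fL gL; rewrite /norm2 -RintegralD//; last 2 first.
- exact: (L2_integrable (L2D fL gL)).
- exact: (L2_integrable (L2B fL gL)).
under eq_Rintegral do rewrite sqnorm_parallelogram.
have iZ f' : L2 mu f' -> mu.-integrable setT (EFin \o (fun x => 2 * sqnorm (f' x))).
  by move=> iu; exact: (integrableZl measurableT 2 (L2_integrable iu)).
rewrite RintegralD ?RintegralZl//; try exact: L2_integrable; exact: iZ.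
Qed.

Lemma norm2Z f (c : R[i]) : L2 mu f -> norm2 (fun x => c * f x) = sqnorm c * norm2 f.
Proof.
move=> fL; rewrite /norm2; under eq_Rintegral do rewrite sqnormM.
by rewrite RintegralZl//; exact: L2_integrable.
Qed.

Lemma norm2_cst (c : R[i]) : norm2 (fun=> c) = sqnorm c.
Proof. by rewrite /norm2 Rintegral_cst//= probability_setT mulr1. Qed.

(* [0 <= norm2 (f - c)] with [c] the mean of [f] *)
Lemma sqnorm_cintegral_le f : L2 mu f -> sqnorm (cintegral mu f) <= norm2 f.
Proof.
move=> fL; set c := cintegral mu f.
have [i1 i2] := L2_cintegrable fL.
have iZ (k : R) u : mu.-integrable setT (EFin \o u) ->
    mu.-integrable setT (EFin \o (fun x => k * u x)).
  by move=> iu; exact: (integrableZl measurableT k iu).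
have iC (k : R) : mu.-integrable setT (EFin \o (fun=> k)) := integrable_cst k.
have iD (u v : R -> R) : mu.-integrable setT (EFin \o u) ->
    mu.-integrable setT (EFin \o v) -> mu.-integrable setT (EFin \o (fun x => u x + v x)).
  by move=> iu iv; exact: (integrableD measurableT iu iv).
have := norm2_ge0 (fun x => f x - c); rewrite /norm2.
have -> : (fun x => sqnorm (f x - c)) =
  (fun x => sqnorm (f x) + (- 2 * Re c * Re (f x) + (- 2 * Im c * Im (f x) + sqnorm c))).
  by apply/funext => x; case: (f x) c => a b [a' b']; rewrite /sqnorm /=; ring.
have I1 := iZ (- 2 * Re c) _ i1; have I2 := iZ (- 2 * Im c) _ i2.
have I3 := iD _ _ I2 (iC (sqnorm c)).
rewrite (RintegralD measurableT (L2_integrable fL) (iD _ _ I1 I3)).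
rewrite (RintegralD measurableT I1 I3) (RintegralD measurableT I2 (iC (sqnorm c))).
rewrite !RintegralZl// Rintegral_cst//= probability_setT mulr1.
rewrite -/(Re c) -[Rintegral mu setT (fun x => Re (f x))]/(Re c).
rewrite -[Rintegral mu setT (fun x => Im (f x))]/(Im c).
by rewrite -/(norm2 f) /sqnorm; lra.
Qed.

End ComplexIntegration.

(** * Integrals against the invariant measure, and its bounded support *)

Lemma measurable_norm_gt (R : realType) (r : R) : measurable [set x : R | r < `|x|].
Proof.
rewrite (_ : [set x : R | r < `|x|] = Num.norm @^-1` `]r, +oo[%classic).
  by rewrite -[X in measurable X]setTI; exact: normr_measurable.
by apply/seteqP; split => x /=; rewrite in_itv/= andbT.
Qed.

Section InvariantMeasure.
Variables (R : realType) (mu : probability R R) (Rs : int) (B : seq int).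
Hypothesis B0 : (0 < size B)%N.
Hypothesis mu_inv : forall E, measurable E ->
  (mu E = ((size B)%:R^-1)%:E * \sum_(b <- B) mu (tau Rs b @^-1` E))%E.
Local Notation tau := (@tau R Rs).
Local Notation N := ((size B)%:R : R).

(** Invariance says that [mu] is the average of its pushforwards under the [tau b]; the rest is a
    change of variables. *)
Lemma ge0_integral_invariant (u : R -> \bar R) : measurable_fun setT u ->
  (forall x, 0 <= u x)%E ->
  (\int[mu]_x u x = (N^-1)%:E * \sum_(b <- B) \int[mu]_x u (tau b x))%E.
Proof.
move=> mU u0.
(* The pushforwards are indexed by positions in [B], since [msum] adds up a sequence of measures. *)
pose m n : {measure set R -> \bar R} :=
  measure_function_pushforward__canonical__measure_function_Measure mu
    (@measurable_tau R Rs (nth 0 B n)).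
have N0 : 0 <= N^-1 by rewrite invr_ge0.
have muE A : measurable A -> A `<=` setT ->
    mu A = mscale (NngNum N0) (msum m (size B)) A.
  move=> mA _; rewrite mu_inv// /mscale /= /msum; congr (_ * _)%E.
  by rewrite (big_nth 0) big_mkord.
rewrite (eq_measure_integral _ muE) ge0_integral_mscale//=; congr (_ * _)%E.
rewrite ge0_integral_measure_sum// (big_nth 0) big_mkord; apply: eq_bigr => i _.
rewrite /m ge0_integral_pushforward//.
exact: measurable_tau.
Qed.

(** The integrals of [|u|] along the branches are nonnegative and have a finite sum, so each is
    finite. *)
Lemma integrable_tau (u : R -> R) b : b \in B ->
  mu.-integrable setT (EFin \o u) -> mu.-integrable setT (EFin \o (fun x => u (tau b x))).
Proof.
move=> bB /integrableP[mU iu]; apply/integrableP; split.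
  apply: (measurableT_comp mU); exact: measurable_tau.
have mU' : measurable_fun setT (fun x => `|(EFin \o u) x|%E) by exact: measurableT_comp.
move: iu; rewrite ge0_integral_invariant//.
rewrite (big_rem b)//= muleC => fin.
have {}fin : (\int[mu]_x `|(u (tau b x))%:E| + \sum_(b' <- rem b B)
    \int[mu]_x `|(u (tau b' x))%:E| < +oo)%E.
  rewrite ltey; apply/eqP => e; move: fin; rewrite e gt0_mulye ?ltxx//.
  by rewrite lte_fin invr_gt0 ltr0n.
apply: le_lt_trans fin; rewrite leeDl//.
by apply: sume_ge0 => i _; exact: integral_ge0.
Qed.

Lemma Rintegral_invariant (u : R -> R) : mu.-integrable setT (EFin \o u) ->
  Rintegral mu setT u = N^-1 * \sum_(b <- B) Rintegral mu setT (fun x => u (tau b x)).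
Proof.
have pos (v : R -> R) : (forall x, 0 <= v x) -> mu.-integrable setT (EFin \o v) ->
    Rintegral mu setT v = N^-1 * \sum_(b <- B) Rintegral mu setT (fun x => v (tau b x)).
  move=> v0 iv; rewrite /Rintegral ge0_integral_invariant; last 2 first.
  - by case/integrableP: iv.
  - by move=> x; rewrite lee_fin.
  have fin b : b \in B -> (\int[mu]_x (v (tau b x))%:E)%E \is a fin_num.
    by move=> bB; apply: integrable_fin_num => //; exact: integrable_tau.
  rewrite fineM//; last first.
    rewrite big_seq sum_fin_num; apply/allP => x /mapP[b].
    by rewrite mem_filter => /andP[bB _] ->; exact: fin.
  by rewrite /= big_seq [in RHS]big_seq sum_fine// => b; exact: fin.
move=> iu.
have ia : mu.-integrable setT (EFin \o (fun x => `|u x|)) by exact: integrable_norm iu.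
have isum : mu.-integrable setT (EFin \o (fun x => u x + `|u x|)).
  exact: (integrableD measurableT iu ia).
(* A difference of two nonnegative integrable functions, to each of which [pos] applies. *)
have uE : u = (fun x => (u x + `|u x|) - `|u x|) by apply/funext => x; rewrite addrK.
rewrite [in LHS]uE RintegralB// !pos//; last first.
  by move=> x; have := ler_norm (- u x); rewrite normrN; lra.
rewrite -mulrBr -sumrB; congr (_ * _); rewrite big_seq [RHS]big_seq.
apply: eq_bigr => b bB; rewrite -RintegralB//; last 2 first.
- exact: (@integrable_tau (fun x => u x + `|u x|)).
- exact: (@integrable_tau (fun x => `|u x|)).
by congr Rintegral; apply/funext => x; rewrite addrK.
Qed.

Lemma cintegral_invariant (f : R -> R[i]) : cintegrable mu f ->
  cintegral mu f = (N^-1)%:C%C * \sum_(b <- B) cintegral mu (fun x => f (tau b x)).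
Proof.
move=> [f1 f2]; apply: complex_eq.
  rewrite cReM /= mul0r subr0 (@Rintegral_invariant (fun x => complex.Re (f x)))//.
  by congr (_ * _); elim: (B) => [|b s IH]; rewrite ?big_nil// !big_cons IH cReD.
rewrite cImM /= mul0r addr0 (@Rintegral_invariant (fun x => complex.Im (f x)))//.
by congr (_ * _); elim: (B) => [|b s IH]; rewrite ?big_nil// !big_cons IH cImD.
Qed.

Lemma L2_tau (f : R -> R[i]) b : b \in B -> L2 mu f -> L2 mu (fun x => f (tau b x)).
Proof.
move=> bB fL.
apply: (@L2_dominated _ _ _ (fun x => sqnorm (f (tau b x)))) => //.
  by apply: cmeasurable_comp (L2_measurable fL) _; exact: measurable_tau.
exact: (integrable_tau bB (L2_integrable fL)).
Qed.

Lemma norm2_invariant (f : R -> R[i]) : L2 mu f ->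
  norm2 mu f = N^-1 * \sum_(b <- B) norm2 mu (fun x => f (tau b x)).
Proof. by move=> fL; rewrite /norm2 Rintegral_invariant//; exact: L2_integrable. Qed.

(** For [r >= beta + 1], [|tau b x| > r] forces [|x| > 2 * r - beta >= r + 1]. By invariance the
    tail at [r] then weighs no more than the tail at [r + 1], and the tails tend to 0. *)
Lemma bounded_support : (2 <= `|Rs|)%R -> exists r : R, mu [set x | r < `|x|] = 0%E.
Proof.
move=> Rs2.
have Rs2R : 2 <= `|Rs%:~R| :> R by rewrite -intr_norm (_ : 2 = 2%:~R)// ler_int.
pose beta : R := \sum_(b <- B) `|b%:~R|.
pose A (r : R) := [set x : R | r < `|x|].
have mA r : measurable (A r) := measurable_norm_gt r.
have mono (r : R) : beta + 1 <= r -> (mu (A r) <= mu (A (r + 1)%R))%E.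
  move=> rb; rewrite mu_inv//.
  apply: (@le_trans _ _ ((N^-1)%:E * \sum_(b <- B) mu (A (r + 1)%R))%E).
    rewrite lee_wpmul2l ?lee_fin ?invr_ge0//; rewrite big_seq [leRHS]big_seq.
    apply: lee_sum => b bB; apply: le_measure; rewrite ?inE//.
      by rewrite -[X in measurable X]setTI; apply: measurable_tau.
    move=> x; rewrite /A /= /Defs.tau normrM normfV ltr_pdivlMr; last by move: Rs2R; lra.
    have : `|x + b%:~R| <= `|x| + `|b%:~R| := ler_normD _ _.
    have : `|b%:~R| <= beta by exact: (ler_sum_term (F := fun b : int => `|b%:~R| : R)).
    have beta0 : 0 <= beta by rewrite sumr_ge0.
    have : 0 <= r * (`|Rs%:~R| - 2) by rewrite mulr_ge0 ?subr_ge0//; lra.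
    by lra.
  have Am : mu (A (r + 1)) \is a fin_num by rewrite fin_num_measure.
  rewrite -(fineK Am) sumEFin big_const_seq count_predT iter_addr addr0 -EFinM lee_fin.
  by rewrite -[fine _ *+ _]mulr_natl mulrA mulVf ?mul1r// pnatr_eq0 -lt0n.
exists (beta + 1).
have monon n : (mu (A (beta + 1)%R) <= mu (A (beta + 1 + n%:R)%R))%E.
  elim: n => [|n IH]; first by rewrite addr0.
  by rewrite (le_trans IH)// -natr1 addrA mono// lerDl.
have cap0 : \bigcap_n (A (beta + 1 + n%:R)) = set0.
  apply/seteqP; split => // x /(_ (Num.truncn `|x|).+1 I) /=; rewrite /A/= => h.
  have := truncnS_gt `|x|; have : 0 <= beta by rewrite sumr_ge0.
  by move: h; lra.
have : mu (A (beta + 1 + n%:R)) @[n --> \oo] --> mu (\bigcap_n (A (beta + 1 + n%:R))).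
  apply: nonincreasing_cvg_mu => //.
  - by rewrite (@le_lt_trans _ _ 1%E) ?probability_le1 ?ltry.
  - by rewrite cap0.
  - move=> n m nm; apply/subsetPset => x; rewrite /A /=; apply: le_lt_trans.
    by rewrite lerD2l ler_nat.
rewrite cap0 measure0 => cv.
apply/eqP; rewrite eq_le measure_ge0 andbT -(cvg_lim _ cv)//.
apply: lime_ge; first by apply/cvg_ex; exists 0%E.
by apply: nearW.
Qed.

End InvariantMeasure.

(** * Exponentials of real frequency, the Fourier transform of [mu], and the mask of [B] *)

Section Waves.
Variable R : realType.
Implicit Types (f g : R -> R[i]) (s t x : R).

(** [e_] with a real frequency, because the maps [inv_branch] leave the integers. *)
Definition wave t x : R[i] := cexp2pi (t * x).

Lemma waveD s t x : wave (s + t) x = wave s x * wave t x.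
Proof. by rewrite /wave mulrDl cexp2piD. Qed.

Lemma sqnorm_wave t x : sqnorm (wave t x) = 1.
Proof. exact: sqnorm_cexp2pi. Qed.

Lemma cmeasurable_wave t : cmeasurable (wave t).
Proof. by apply: cmeasurable_comp (cmeasurable_cexp2pi R) _; exact: measurable_funM. Qed.

Lemma L2_wave (mu : probability R R) t : L2 mu (wave t).
Proof.
apply: (@L2_bounded _ _ _ 1); first exact: cmeasurable_wave.
by move=> x; rewrite sqnorm_wave.
Qed.

Lemma norm2_wave (mu : probability R R) t : norm2 mu (wave t) = 1.
Proof.
rewrite -[RHS]sqnorm1 -(norm2_cst mu 1).
by congr Rintegral; apply/funext => x; rewrite sqnorm_wave sqnorm1.
Qed.

Definition ccontinuous f :=
  continuous (fun x => complex.Re (f x)) /\ continuous (fun x => complex.Im (f x)).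

Lemma ccontinuousM f g : ccontinuous f -> ccontinuous g -> ccontinuous (fun x => f x * g x).
Proof.
move=> [f1 f2] [g1 g2]; split.
  under eq_fun do rewrite cReM.
  by move=> x; apply: cvgB; apply: cvgM; [exact: f1|exact: g1|exact: f2|exact: g2].
under eq_fun do rewrite cImM.
by move=> x; apply: cvgD; apply: cvgM; [exact: f1|exact: g2|exact: f2|exact: g1].
Qed.

Lemma ccontinuousD f g : ccontinuous f -> ccontinuous g -> ccontinuous (fun x => f x + g x).
Proof.
move=> [f1 f2] [g1 g2]; split.
  by under eq_fun do rewrite cReD; move=> x; apply: cvgD; [exact: f1|exact: g1].
by under eq_fun do rewrite cImD; move=> x; apply: cvgD; [exact: f2|exact: g2].
Qed.

Lemma ccontinuous_cst (c : R[i]) : ccontinuous (fun=> c).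
Proof. by split => x; exact: cvg_cst. Qed.

Lemma ccontinuous_sum (I : Type) (r : seq I) (f : I -> R -> R[i]) :
  (forall i, ccontinuous (f i)) -> ccontinuous (fun x => \sum_(i <- r) f i x).
Proof.
move=> cf; elim: r => [|i r IH].
  by under eq_fun do rewrite big_nil; exact: ccontinuous_cst.
by under eq_fun do rewrite big_cons; exact: ccontinuousD.
Qed.

Lemma ccontinuous_wave t : ccontinuous (wave t).
Proof.
have lin : continuous (fun x : R => 2 * pi * (t * x)).
  by move=> x; apply: cvgMr; apply: cvgMr; exact: cvg_id.
by split => x; apply: continuous_comp (lin x) _; [exact: continuous_cos|exact: continuous_sin].
Qed.

Lemma wave_sym s t : wave s t = wave t s. Proof. by rewrite /wave mulrC. Qed.

Lemma continuous_sqnorm f : ccontinuous f -> continuous (fun x => sqnorm (f x)).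
Proof.
move=> [f1 f2]; under eq_fun do rewrite /sqnorm !expr2.
by move=> x; apply: cvgD; apply: cvgM; [exact: f1|exact: f1|exact: f2|exact: f2].
Qed.

(** Continuity under the integral sign near [t]: sines and cosines are dominated by the constant
    1. *)
Lemma ccontinuous_fourier (mu : probability R R) :
  ccontinuous (fun t => cintegral mu (wave t)).
Proof.
split => t.
- have := @continuity_under_integral R _ R mu (fun t x => complex.Re (wave t x))
    setT measurableT (t - 1) (t + 1) _ _ (cst 1) _ _ t; apply.
  + by move=> s _; case: (L2_cintegrable (L2_wave mu s)).
  + apply: aeW => x _ s _.
    have [+ _] := ccontinuous_wave x.
    by under eq_fun do rewrite wave_sym; exact.
  + exact: integrable_cst.
  + by move=> s _; apply: aeW => x _ /=; rewrite ler_norml cos_geN1 cos_le1.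
  + by rewrite inE /= in_itv /= ltrBlDr ltrDl ltr01.
- have := @continuity_under_integral R _ R mu (fun t x => complex.Im (wave t x))
    setT measurableT (t - 1) (t + 1) _ _ (cst 1) _ _ t; apply.
  + by move=> s _; case: (L2_cintegrable (L2_wave mu s)).
  + apply: aeW => x _ s _.
    have [_] := ccontinuous_wave x.
    by under eq_fun do rewrite wave_sym; exact.
  + exact: integrable_cst.
  + by move=> s _; apply: aeW => x _ /=; rewrite ler_norml sin_geN1 sin_le1.
  + by rewrite inE /= in_itv /= ltrBlDr ltrDl ltr01.
Qed.

Variable B : seq int.
Hypothesis B0 : (0 < size B)%N.

(** The function [m_B], that is, the Fourier transform of the uniform probability on [B]. *)
Definition mask t : R[i] := (((size B)%:R : R)^-1)%:C%C * \sum_(b <- B) wave b%:~R t.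

Lemma ccontinuous_mask : ccontinuous mask.
Proof.
apply: ccontinuousM; first exact: ccontinuous_cst.
by apply: ccontinuous_sum => b; exact: ccontinuous_wave.
Qed.

(** Up to a factor of modulus 1 and a constant, the mask is a polynomial in [cexp2pi t]; each of its
    finitely many roots has one preimage [t] per integer part. *)
Lemma finite_mask_zeros (K : R) : exists s : seq R,
  forall t, `|t| <= K -> mask t = 0 -> t \in s.
Proof.
(* Shifting by [M] makes all the exponents nonnegative. *)
pose M : int := \sum_(b <- B) `|b|.
have bM b : b \in B -> 0 <= b + M.
  move=> bB; have : `|b| <= M by exact: (ler_sum_term (F := fun b : int => `|b|)).
  by lia.
pose P : {poly R[i]} := \sum_(b <- B) 'X^(absz (b + M)).
have Pcexp t : P.[cexp2pi t] = wave M%:~R t * \sum_(b <- B) wave b%:~R t.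
  rewrite mulr_sumr horner_sum big_seq [RHS]big_seq; apply: eq_bigr => b bB.
  rewrite hornerXn -waveD -intrD [M + b]addrC /wave.
  have -> : ((b + M)%:~R : R) = (absz (b + M))%:R by rewrite -[b + M]gez0_abs ?bM.
  elim: (absz _) => [|n IH]; first by rewrite expr0 mul0r cexp2pi0.
  by rewrite exprS IH -natr1 mulrDl mul1r cexp2piD mulrC.
(* The value of [P] at 1 is [size B]. *)
have P0 : P != 0.
  apply/eqP => P0; have := Pcexp 0; rewrite P0 horner0 => /esym/eqP.
  rewrite /wave mulr0 cexp2pi0 mul1r.
  under eq_bigr do rewrite mulr0 cexp2pi0.
  rewrite big_const_seq count_predT iter_addr addr0 (_ : 1 *+ size B = (size B)%:R)//.
  by rewrite pnatr_eq0 -leqn0 leqNgt B0.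
have [rs Prs] := closed_field_poly_normal P.
(* Where no such [t] exists [xget] returns 0, a harmless extra point of the list. *)
pose point z (m : int) := xget (0 : R) [set t | cexp2pi t = z /\ Num.floor t = m].
(* As [k > K + 1], the integer parts are among the [2k + 1] integers from [-k] to [k]. *)
pose k := (Num.truncn K).+2.
exists [seq point z m | z <- rs, m <- [seq i%:Z - k%:Z | i <- iota 0 (k + k).+1]].
move=> t tK mt.
have zrs : cexp2pi t \in rs.
  have : root P (cexp2pi t).
    rewrite rootE Pcexp (_ : \sum_(b <- B) _ = 0) ?mulr0//.
    apply/eqP; move/eqP: mt; rewrite /mask mulf_eq0 => /orP[|//].
    rewrite eq_complex /= eqxx andbT invr_eq0 pnatr_eq0.
    by move=> /eqP NB; move: B0; rewrite NB.
  by rewrite Prs rootZ ?lead_coef_eq0// root_prod_XsubC.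
have tE : t = point (cexp2pi t) (Num.floor t).
  have [e1 e2] := @xgetPex _ (0 : R) [set t' | cexp2pi t' = cexp2pi t /\
    Num.floor t' = Num.floor t] (ex_intro _ t (conj erefl erefl)).
  rewrite -/(point _ _) in e1 e2.
  apply/esym/cexp2pi_inj => //.
  have := floor_itv t; have := floor_itv (point (cexp2pi t) (Num.floor t)).
  by rewrite e2 intrD ltr_distl; lra.
rewrite [X in X \in _]tE; apply: allpairs_f => //.
have Kk : K + 1 < k%:R by rewrite /k -natr1 ltrD2r truncnS_gt.
have fl1 : - (k%:Z) <= Num.floor t.
  rewrite -(ler_int R) intrN; have := floor_itv t; rewrite intrD.
  by move: tK; rewrite ler_norml; lra.
have fl2 : Num.floor t <= k%:Z.
  rewrite -(ler_int R); have := floor_itv t; rewrite intrD.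
  by move: tK; rewrite ler_norml; lra.
apply/mapP; exists (absz (Num.floor t + k%:Z)); last by lia.
by rewrite mem_iota; lia.
Qed.

End Waves.

(** * Polynomials converging to a step function on [[0, 1]] *)

Section StepPolynomials.
Variable R : realType.
Implicit Types (u y : R).

Lemma bernoulli_ineq u m : -1 <= u -> 1 + m%:R * u <= (1 + u) ^+ m.
Proof.
move=> u1; elim: m => [|m IH]; first by rewrite mul0r addr0 expr0.
rewrite exprS -natr1; apply: (@le_trans _ _ ((1 + u) * (1 + m%:R * u))).
  have : 0 <= m%:R * (u * u) by rewrite mulr_ge0// -expr2 sqr_ge0.
  by lra.
by rewrite ler_wpM2l//; lra.
Qed.

(** Of the type [(1 - y^m)^M] used in the Brosowski-Deutsch proof of Stone-Weierstrass. Here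
    [M * y^m] is [(2 * (2 * y) ^ n) ^ n], which tends to 0 for [y < 1/2] and is at least [2 ^ n] for
    [y >= 1/2]. *)
Definition step_poly n y : R := (1 - y ^+ (n * n)) ^+ (2 ^ (n * n + n)).

Lemma step_poly_itv n y : 0 <= y <= 1 -> 0 <= step_poly n y <= 1.
Proof.
move=> /andP[y0 y1]; have h0 := exprn_ge0 (n * n) y0.
have h1 : y ^+ (n * n) <= 1 by rewrite exprn_ile1.
by rewrite /step_poly exprn_ge0 ?exprn_ile1//; lra.
Qed.

Let cvg_half : (2^-1 : R) ^+ n @[n --> \oo] --> 0.
Proof. by apply: cvg_expr; rewrite ger0_norm ?invr_ge0// invf_lt1// ltr1n. Qed.

Lemma cvg_step_poly_lt y : 0 <= y < 2^-1 -> step_poly n y @[n --> \oo] --> (1 : R).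
Proof.
move=> /andP[y0 y2]; apply/cvgrPdist_le => e e0.
have z1 : `|2 * y| < 1 by rewrite ger0_norm ?mulr_ge0//; lra.
have cz := cvg_expr z1.
(* Once [(2 * y) ^ n <= 1/4], the base [2 * (2 * y) ^ n] is at most [1/2], and Bernoulli bounds the
   error by [2^-n]. *)
have q0 : 0 < 4^-1 :> R by rewrite invr_gt0.
near=> n.
have hn : (2^-1 : R) ^+ n <= e.
  near: n; have /cvgrPdist_le/(_ _ e0) := cvg_half; apply: filterS => n.
  by rewrite sub0r normrN ger0_norm// exprn_ge0.
have zn : (2 * y) ^+ n <= 4^-1.
  near: n; have /cvgrPdist_le/(_ _ q0) := cz; apply: filterS => n.
  by rewrite sub0r normrN ger0_norm// exprn_ge0// mulr_ge0.
have /andP[s0 s1] : 0 <= step_poly n y <= 1 by apply: step_poly_itv; lra.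
rewrite ger0_norm ?subr_ge0//; apply: le_trans hn.
have yn1 : y ^+ (n * n) <= 1 by rewrite exprn_ile1//; lra.
have := @bernoulli_ineq (- y ^+ (n * n)) (2 ^ (n * n + n)); rewrite -/(step_poly n y) => bn.
have {bn} : 1 + (2 ^ (n * n + n))%:R * - y ^+ (n * n) <= step_poly n y by apply: bn; lra.
have -> : (2 ^ (n * n + n))%:R * - y ^+ (n * n) = - (2 * (2 * y) ^+ n) ^+ n.
  by rewrite natrX exprD exprMn -exprM exprMn; ring.
have : (2 * (2 * y) ^+ n) ^+ n <= (2^-1) ^+ n.
  have p0 : 0 <= (2 * y) ^+ n by rewrite exprn_ge0// mulr_ge0.
  by apply: lerXn2r; rewrite ?nnegrE; lra.
by lra.
Unshelve. all: by end_near. Qed.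

(** With [v = 2^-(n * n) <= y ^ (n * n)], the product [(1 - v)^M (1 + v)^M] is at most 1, while
    Bernoulli gives [(1 + v)^M >= 2 ^ n]. *)
Lemma cvg_step_poly_ge y : 2^-1 <= y <= 1 -> step_poly n y @[n --> \oo] --> (0 : R).
Proof.
move=> /andP[y2 y1]; apply/cvgrPdist_le => e e0.
near=> n.
have hn : (2^-1 : R) ^+ n <= e.
  near: n; have /cvgrPdist_le/(_ _ e0) := cvg_half; apply: filterS => n.
  by rewrite sub0r normrN ger0_norm// exprn_ge0.
have /andP[s0 s1] : 0 <= step_poly n y <= 1 by apply: step_poly_itv; lra.
rewrite sub0r normrN ger0_norm//; apply: le_trans hn.
pose v : R := 2^-1 ^+ (n * n).
have v0 : 0 <= v by rewrite exprn_ge0.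
have v1 : v <= 1 by rewrite exprn_ile1//; lra.
have vy : v <= y ^+ (n * n) by apply: lerXn2r; rewrite ?nnegrE; lra.
have y1n : y ^+ (n * n) <= 1 by rewrite exprn_ile1//; lra.
pose M := (2 ^ (n * n + n))%N.
have sv : step_poly n y <= (1 - v) ^+ M by apply: lerXn2r; rewrite ?nnegrE; lra.
have bn : 1 + M%:R * v <= (1 + v) ^+ M by apply: bernoulli_ineq; lra.
have Mv : M%:R * v = 2 ^+ n.
  by rewrite /M natrX exprD /v mulrAC -exprMn mulfV ?pnatr_eq0// expr1n mul1r.
have p : (1 - v) ^+ M * (1 + v) ^+ M <= 1.
  rewrite -exprMn; have vv : 0 <= v * v by rewrite mulr_ge0.
  have vv1 : v * v <= 1 by apply: mulr_ile1.
  by apply: exprn_ile1; lra.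
have w0 : 0 <= (1 - v) ^+ M by rewrite exprn_ge0//; lra.
have t0 : 0 < 2 ^+ n :> R by rewrite exprn_gt0.
rewrite exprVn -[leRHS]div1r ler_pdivlMr//.
apply: le_trans p; apply: ler_pM => //.
by rewrite -Mv; lra.
Unshelve. all: by end_near. Qed.

End StepPolynomials.

(** * Trigonometric polynomials with real frequencies *)

Section TrigonometricPolynomials.
Variable R : realType.

Inductive trigpoly : (R -> R[i]) -> Prop :=
| trigpoly_wave c t : trigpoly (fun x => c * wave t x)
| trigpolyD f g : trigpoly f -> trigpoly g -> trigpoly (fun x => f x + g x).

Lemma trigpolyM f g : trigpoly f -> trigpoly g -> trigpoly (fun x => f x * g x).
Proof.
elim=> [c t|f1 f2 _ IH1 _ IH2] tg; last first.
  under eq_fun do rewrite mulrDl.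
  by apply: trigpolyD; [exact: IH1|exact: IH2].
elim: tg => [c' t'|g1 g2 _ IH1 _ IH2]; last first.
  by under eq_fun do rewrite mulrDr; exact: trigpolyD.
have -> : (fun x => c * wave t x * (c' * wave t' x)) =
    (fun x => c * c' * wave (t + t') x) by apply/funext => x; rewrite waveD; ring.
exact: trigpoly_wave.
Qed.

Lemma trigpoly_cst c : trigpoly (fun=> c).
Proof.
have -> : (fun=> c) = (fun x => c * wave 0 x).
  by apply/funext => x; rewrite /wave mul0r cexp2pi0 mulr1.
exact: trigpoly_wave.
Qed.

Lemma trigpolyX f n : trigpoly f -> trigpoly (fun x => f x ^+ n).
Proof.
move=> tf; elim: n => [|n IH].
  by under eq_fun do rewrite expr0; exact: trigpoly_cst.
by under eq_fun do rewrite exprS; exact: trigpolyM.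
Qed.

Lemma trigpoly_sin s : trigpoly (fun x => (sin (2 * pi * (s * x)))%:C%C).
Proof.
(* [c] is [1 / (2i)], from Euler's formula for the sine. *)
pose c : R[i] := Complex 0 (- 2^-1).
have -> : (fun x => (sin (2 * pi * (s * x)))%:C%C) =
    (fun x => c * wave s x + (- c) * wave (- s) x).
  apply/funext => x; rewrite /wave (mulNr s x) -conjc_cexp2pi /cexp2pi.
  by apply: complex_eq; rewrite /c /=; lra.
by apply: trigpolyD; exact: trigpoly_wave.
Qed.

(** For [a] in [[-1, 1]] the affine map takes values in [[0, 1]], and the jump at [1/2] falls where
    the sine equals [a]. *)
Lemma trigpoly_step n s a : trigpoly (fun x =>
  (step_poly n (2^-1 + (sin (2 * pi * (s * x)) - a) * 4^-1))%:C%C).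
Proof.
have rD (x y : R) : ((x + y)%:C = x%:C + y%:C)%C by exact: rmorphD.
have rM (x y : R) : ((x * y)%:C = x%:C * y%:C)%C by exact: rmorphM.
have rX (x : R) m : ((x ^+ m)%:C = x%:C ^+ m)%C by exact: rmorphXn.
have affine : trigpoly (fun x => (2^-1 + (sin (2 * pi * (s * x)) - a) * 4^-1)%:C%C).
  under eq_fun do rewrite !(rD, rM).
  apply: trigpolyD; first exact: trigpoly_cst.
  apply: trigpolyM; last exact: trigpoly_cst.
  by apply: trigpolyD; [exact: trigpoly_sin|exact: trigpoly_cst].
rewrite /step_poly.
under eq_fun do rewrite rX rD -[X in (- X)%:C%C]mul1r -mulNr rM rX.
apply: trigpolyX; apply: trigpolyD; first exact: trigpoly_cst.
by apply: trigpolyM; [exact: trigpoly_cst|exact: trigpolyX].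
Qed.

End TrigonometricPolynomials.

(** * Density of the waves in [L^2(mu)], as an induction principle *)

Section WaveDensity.
Variables (R : realType) (mu : probability R R) (r : R).
Hypothesis mu_tail : mu [set x | r < `|x|] = 0%E.
Variable V : (R -> R[i]) -> Prop.
Hypothesis V_wave : forall t, V (wave t).
Hypothesis V_D : forall f g, V f -> V g -> V (fun x => f x + g x).
Hypothesis V_Z : forall c f, V f -> V (fun x => c * f x).
Hypothesis V_closed : forall f, L2 mu f ->
  (forall eps, 0 < eps -> exists2 g, V g & norm2 mu (fun x => f x - g x) <= eps) -> V f.
Implicit Types (u v G : R -> R).

Let Vr u := V (fun x => (u x)%:C%C).

Let Vr_D u v : Vr u -> Vr v -> Vr (fun x => u x + v x).
Proof.
move=> Vu Vv; have := V_D Vu Vv; congr V; apply/funext => x.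
by rewrite (rmorphD (real_complex R)).
Qed.

Let Vr_Z (c : R) u : Vr u -> Vr (fun x => c * u x).
Proof.
move=> Vu; have := V_Z c%:C%C Vu; congr V; apply/funext => x.
by rewrite (rmorphM (real_complex R)).
Qed.

Let V_trigpoly f : trigpoly f -> V f.
Proof. by elim=> [c t|f1 f2 _ V1 _ V2]; [exact: V_Z|exact: V_D]. Qed.

Let Vr_cst (c : R) : Vr (fun=> c).
Proof. by apply: V_trigpoly; exact: trigpoly_cst. Qed.

Let Vr_sum (I : Type) (s : seq I) (u : I -> R -> R) :
  (forall i, Vr (u i)) -> Vr (fun x => \sum_(i <- s) u i x).
Proof.
move=> Vu; elim: s => [|i s IH].
  by under eq_fun do rewrite big_nil; exact: Vr_cst.
by under eq_fun do rewrite big_cons; exact: Vr_D.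
Qed.

(** The squared differences are at most [4 * G^2] and tend to 0 off the null set [|x| > r], so
    dominated convergence supplies the approximations for [V_closed]. *)
Let Vr_dominated (u_ : nat -> R -> R) u G :
  (forall n, measurable_fun setT (u_ n)) -> measurable_fun setT u ->
  (forall n, Vr (u_ n)) ->
  (forall x, `|x| <= r -> u_ ^~ x @ \oo --> u x) ->
  (forall n x, `|u_ n x| <= G x) -> (forall x, `|u x| <= G x) ->
  mu.-integrable setT (EFin \o (fun x => G x ^+ 2)) -> Vr u.
Proof.
move=> mu_ mU Vu cvu uG uG' iG.
have G0 x : 0 <= G x by apply: le_trans (uG' x).
apply: V_closed.
  apply: L2_dominated iG _; first exact: cmeasurable_real.
  move=> x; rewrite /sqnorm /= expr0n addr0 -[u x ^+ 2]real_normK ?num_real//.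
  by apply: lerXn2r; rewrite ?nnegrE.
move=> eps eps0.
have i4 : mu.-integrable setT (EFin \o (fun x => 4 * G x ^+ 2)).
  exact: (integrableZl measurableT 4 iG).
have mdiff n : measurable_fun setT (fun x => (u x - u_ n x) ^+ 2).
  by apply: measurable_funX; exact: measurable_funB.
have [||||_ _] := @dominated_convergence _ _ R mu setT measurableT
  (fun n x => ((u x - u_ n x) ^+ 2)%:E) (fun=> 0%E)
  (fun x => (4 * G x ^+ 2)%:E) _ _ _ i4.
- by move=> n; apply/measurable_EFinP.
- exact: measurable_cst.
- exists [set x | r < `|x|]; split => //; first exact: measurable_norm_gt.
  move=> x /= nx; rewrite ltNge; apply/negP => xr; apply: nx => _.
  rewrite -[0%E]/(0%:E); apply: cvg_EFin; first exact: nearW.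
  have cd : u x - u_ n x @[n --> \oo] --> u x - u x.
    by apply: cvgB; [exact: cvg_cst|exact: cvu].
  by have := cvgM cd cd; rewrite subrr mul0r; exact.
- apply: aeW => x n _ /=; rewrite lee_fin ger0_norm ?sqr_ge0//.
  rewrite -real_normK ?num_real// (_ : 4 * G x ^+ 2 = (2 * G x) ^+ 2); last by ring.
  apply: lerXn2r; rewrite ?nnegrE ?mulr_ge0//.
  by apply: le_trans (ler_normB _ _) _; have := uG n x; have := uG' x; lra.
rewrite integral0 => /fine_cvg/cvgrPdist_le/(_ _ eps0)[n _ /(_ n (leqnn n))] /=.
rewrite sub0r normrN => le; exists (fun x => (u_ n x)%:C%C); first exact: Vu.
apply: le_trans le; apply: le_trans (ler_norm _); rewrite /norm2 /Rintegral.
by under eq_integral do rewrite -(rmorphB (real_complex R)) /sqnorm /= expr0n addr0.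
Qed.

Let i1 : mu.-integrable setT (EFin \o (fun=> (1 : R) ^+ 2)).
Proof. exact: integrable_cst. Qed.

(* On [|x| <= rho] the function [sin (2 pi s x)] with [s = 1 / (4 rho)] is
   increasing, so the step polynomials in it separate [x < a] from [x >= a]. *)
Let Vr_ray (a : R) : Vr (\1_(`]-oo, a[%classic)).
Proof.
(* [rho] exceeds [|r|] and [|a|], so the angles of [a] and of all [x] with [|x| <= r] lie in
   [[-pi/2, pi/2]], where the sine increases. *)
pose rho : R := `|r| + `|a| + 1.
have rho0 : 0 < rho by rewrite /rho; have := normr_ge0 r; have := normr_ge0 a; lra.
pose s : R := (4 * rho)^-1.
pose ang x : R := 2 * pi * (s * x).
pose y x : R := 2^-1 + (sin (ang x) - sin (ang a)) * 4^-1.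
have angE x : ang x = pi / 2 * (x / rho) by rewrite /ang /s; field; rewrite gt_eqF.
have pi0 := @pi_gt0 R.
have ang_itv x : `|x| <= rho -> ang x \in `[- (pi / 2), (pi / 2)].
  rewrite in_itv /= -ler_norml angE normrM (@ger0_norm _ (pi / 2)); last by lra.
  move=> xr; rewrite ler_piMr//; first by lra.
  by rewrite normrM normfV (ger0_norm (ltW rho0)) ler_pdivrMr// mul1r.
have aitv : ang a \in `[- (pi / 2), (pi / 2)].
  by apply: ang_itv; rewrite /rho; have := normr_ge0 r; lra.
have y01 x : 0 <= y x <= 1.
  have := sin_geN1 (ang x); have := sin_le1 (ang x).
  by have := sin_geN1 (ang a); have := sin_le1 (ang a); rewrite /y; lra.
apply: (@Vr_dominated (fun n x => step_poly n (y x)) _ (fun=> 1)) => //.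
- move=> n; apply: measurable_funX; apply: measurable_funB => //.
  apply: measurable_funX; apply: measurable_funD => //.
  apply: measurable_funM => //; apply: measurable_funB => //.
  have [_ mI] := @cmeasurable_wave R s.
  exact: mI.
- by move=> n; apply: V_trigpoly; exact: trigpoly_step.
- move=> x xr; have xrho : `|x| <= rho.
    by rewrite /rho; have := ler_norm r; have := normr_ge0 a; lra.
  have xy : (x < a) = (y x < 2^-1).
    rewrite /y gtrDl pmulr_llt0 ?invr_gt0// subr_lt0.
    rewrite (ltr_sin (ang_itv _ xrho) aitv).
    by rewrite !angE ltr_pM2l ?ltr_pM2r ?invr_gt0//; lra.
  have /andP[y0 y1] := y01 x.
  rewrite indicE; case: (ltP x a) => xa.
    rewrite mem_set; last by rewrite /= in_itv.
    by apply: cvg_step_poly_lt; rewrite y0 -xy.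
  rewrite memNset; last by rewrite /= in_itv/= => /lt_geF; rewrite xa.
  by apply: cvg_step_poly_ge; rewrite y1 andbT leNgt -xy -leNgt.
- by move=> n x; have /andP[h0 h1] := step_poly_itv n (y01 x); rewrite ger0_norm.
- by move=> x; rewrite indicE ger0_norm// lern1 leq_b1.
Qed.

(** Dynkin's theorem for the rays: complements follow by linearity, disjoint unions by dominated
    convergence of the partial sums. *)
Let Vr_indic (E : set R) : measurable E -> Vr (\1_E).
Proof.
have mE : @measurable _ R = <<s @RGenInftyO.G R >> := RGenInftyO.measurableE R.
rewrite {1}mE; move: E; apply: (dynkin_induction mE).
- move=> _ _ [x ->] [x' ->]; exists (Num.min x x').
  by apply/seteqP; split => z /=; rewrite !in_itv /= lt_min => /andP.
- by rewrite indicT; exact: Vr_cst.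
- by move=> _ [x ->]; exact: Vr_ray.
- move=> S mS VS; have := Vr_D (Vr_cst 1) (Vr_Z (-1) VS); congr Vr.
  by apply/funext => x; rewrite !indicE in_setC; case: (x \in S) => /=; lra.
- move=> F mF tF VF.
  have sumE n x k : F k x -> \sum_(i <- iota 0 n) \1_(F i) x = (k < n)%N%:R :> R.
    move=> Fx; have Fi i : \1_(F i) x = (i == k)%:R :> R.
      rewrite indicE; case: (altP (i =P k)) => [->|ik]; first by rewrite mem_set.
      rewrite memNset// => Fix; move/trivIsetP : tF => /(_ i k I I ik).
      by move=> /seteqP[/(_ x) h _]; apply: h.
    under eq_bigr do rewrite Fi.
    have [kn|nk] := ltnP k n.
      rewrite (bigD1_seq k) ?iota_uniq ?mem_iota//= eqxx big1 ?addr0// => i.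
      by move=> /negbTE ->.
    rewrite big1_seq// => i /andP[_]; rewrite mem_iota add0n => /andP[_ ii].
    by rewrite ltn_eqF// (leq_trans ii).
  have sum0 n x : ~ (\bigcup_k F k) x -> \sum_(i <- iota 0 n) \1_(F i) x = 0 :> R.
    move=> nx; rewrite big1// => i _; rewrite indicE memNset// => Fx.
    by apply: nx; exists i.
  apply: (@Vr_dominated (fun n x => \sum_(i <- iota 0 n) \1_(F i) x) _ (fun=> 1)) => //.
  + by move=> n; apply: measurable_sum => i; exact: measurable_indic.
  + by apply: measurable_indic; exact: bigcup_measurable.
  + by move=> n; exact: Vr_sum.
  + move=> x _; have [[k _ Fx]|nx] := pselect ((\bigcup_k F k) x).
      rewrite indicE mem_set; last by exists k.
      apply: cvg_near_cst; exists k.+1 => // n /= kn.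
      by rewrite (sumE _ _ k)// kn.
    rewrite indicE memNset//; apply: cvg_near_cst; apply: nearW => n.
    by rewrite sum0.
  + move=> n x; have [[k _ Fx]|nx] := pselect ((\bigcup_k F k) x).
      by rewrite (sumE _ _ k)// ger0_norm// lern1 leq_b1.
    by rewrite sum0// normr0.
  + by move=> x; rewrite indicE ger0_norm// lern1 leq_b1.
Qed.

Import HBNNSimple.

(** The simple functions of [nnsfun_approx] lie between 0 and [u] and converge to [u]. *)
Let Vr_ge0 u : measurable_fun setT u -> (forall x, 0 <= u x) ->
  mu.-integrable setT (EFin \o (fun x => u x ^+ 2)) -> Vr u.
Proof.
move=> mU u0 iu.
have mU' : measurable_fun setT (EFin \o u) by apply/measurable_EFinP.
have u0' x : setT x -> (0 <= (EFin \o u) x)%E by rewrite /= lee_fin.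
pose a n : R -> R := nnsfun_approx measurableT mU' n.
have au n x : a n x <= u x.
  by rewrite -lee_fin /a nnsfun_approxE; exact: le_approx.
have a0 n x : 0 <= a n x by exact: fun_ge0.
apply: (@Vr_dominated a _ u) => //.
- move=> n; have -> : a n = fun x =>
      \sum_(c <- finmap.enum_fset (fset_set (range (a n)))) c * \1_(a n @^-1` [set c]) x.
    by apply/funext => x; rewrite {1}/a fimfunE fsbig_finite.
  by apply: Vr_sum => c; apply: Vr_Z; exact: Vr_indic.
- move=> x _; have cv := cvg_nnsfun_approx measurableT mU' u0' (I : setT x).
  exact: (fine_cvg cv).
- by move=> n x; rewrite ger0_norm.
- by move=> x; rewrite ger0_norm.
Qed.

Let Vr_L2 u : measurable_fun setT u ->
  mu.-integrable setT (EFin \o (fun x => u x ^+ 2)) -> Vr u.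
Proof.
move=> mU iu.
have part v : measurable_fun setT v -> (forall x, 0 <= v x) ->
    (forall x, v x <= `|u x|) -> Vr v.
  move=> mv v0 vu; apply: Vr_ge0 => //; apply: le_integrable iu => //.
    by apply/measurable_EFinP; exact: measurable_funX.
  move=> x _ /=; rewrite lee_fin !ger0_norm ?sqr_ge0// -[leRHS]real_normK ?num_real//.
  by apply: lerXn2r; rewrite ?nnegrE.
have mN : measurable_fun setT (fun x => `|u x|) by exact: measurableT_comp.
have Vp : Vr (fun x => (`|u x| + u x) / 2).
  apply: part; first by apply: measurable_funM => //; exact: measurable_funD.
    by move=> x; have := ler_norm (- u x); rewrite normrN; lra.
  by move=> x; have := ler_norm (u x); lra.
have Vn : Vr (fun x => (`|u x| - u x) / 2).
  apply: part; first by apply: measurable_funM => //; exact: measurable_funB.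
    by move=> x; have := ler_norm (u x); lra.
  by move=> x; have := ler_norm (- u x); rewrite normrN; lra.
by have := Vr_D Vp (Vr_Z (-1) Vn); congr Vr; apply/funext => x; lra.
Qed.

(** Meant for [V] the set of functions with vanishing defect; real and imaginary parts are handled
    separately. *)
Theorem wave_dense f : L2 mu f -> V f.
Proof.
move=> fL; have [m1 m2] := L2_measurable fL.
have part v : measurable_fun setT v -> (forall x, v x ^+ 2 <= sqnorm (f x)) -> Vr v.
  move=> mv vf; apply: Vr_L2 => //; apply: le_integrable (L2_integrable fL) => //.
    by apply/measurable_EFinP; exact: measurable_funX.
  by move=> x _ /=; rewrite lee_fin !ger0_norm ?sqr_ge0 ?sqnorm_ge0.
have V1 : Vr (fun x => complex.Re (f x)).
  by apply: part => // x; rewrite /sqnorm lerDl sqr_ge0.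
have V2 : Vr (fun x => complex.Im (f x)).
  by apply: part => // x; rewrite /sqnorm lerDr sqr_ge0.
have := V_D V1 (V_Z (Complex 0 1) V2); congr V; apply/funext => x.
by rewrite [RHS]complexE.
Qed.

End WaveDensity.

(** * Sums over the words of [Omega L] *)

Lemma ler_sum_subset (R : numDomainType) (I : eqType) (s r : seq I) (F : I -> R) :
  uniq s -> {subset s <= r} -> (forall i, 0 <= F i) ->
  \sum_(i <- s) F i <= \sum_(i <- r) F i.
Proof.
move=> + + F0; elim: s r => [|a s IH] r /=.
  by rewrite big_nil sumr_ge0.
move=> /andP[na us] sub; have ar : a \in r by apply: sub; rewrite mem_head.
rewrite big_cons (big_rem a ar) /= lerD2l; apply: IH => // x xs.
have : x \in a :: rem a r by rewrite -(perm_mem (perm_to_rem ar)) sub// in_cons xs orbT.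
by rewrite in_cons => /predU1P[xa|//]; move: na; rewrite -xa xs.
Qed.

Section OmegaWords.
Variable L : seq int.
Hypothesis L_uniq : uniq L.
Hypothesis L0 : 0 \in L.

(* The words of [Omega L] of length at most [n]; prepending a digit to such a
   word leaves [Omega L] only for the word [:: 0]. *)
Fixpoint words (n : nat) : seq (seq int) :=
  if n is n'.+1 then [::] :: rem [:: 0] [seq l :: w | l <- L, w <- words n']
  else [:: [::]].

Lemma nil_in_words n : [::] \in words n.
Proof. by case: n => [|n]; rewrite mem_head. Qed.

Let ext_uniq (s : seq (seq int)) : uniq s -> uniq [seq l :: w | l <- L, w <- s].
Proof. by move=> us; apply: allpairs_uniq => // -[l w] [l' w'] _ _ [-> ->]. Qed.

Lemma words_uniq n : uniq (words n).
Proof.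
elim: n => [//|n IH] /=; have u := ext_uniq IH.
rewrite rem_uniq// andbT; apply/negP => /mem_rem/allpairsP[[l w] [_ _]].
by [].
Qed.

Lemma in_words n w : reflect (Omega L w /\ (size w <= n)%N) (w \in words n).
Proof.
apply: (iffP idP); elim: n w => [|n IH] [|l w] //=.
- by move=> _; split=> //; split=> //; left.
- by move=> _; split=> //; split=> //; left.
- rewrite in_cons/= mem_rem_uniq; last exact: ext_uniq (words_uniq n).
  move=> /andP[lw0 /allpairsP[[l' w'] /= [l'L /IH[[wL wlast] wn] [ll' ww']]]].
  rewrite -{}ll' -{}ww' in l'L wL wlast wn.
  split=> //; split; first by rewrite /= l'L.
  right; case: wlast => [w0|].
    by move: lw0; rewrite w0 => /eqP l0 /= e; apply: l0; rewrite e.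
  by case: (w).
- by case=> -[] _ _; rewrite ltn0.
- move=> [[/= /andP[lL wL] wlast] wn]; rewrite in_cons/= mem_rem_uniq; last exact: ext_uniq (words_uniq n).
  rewrite inE/=; apply/andP; split.
    by apply/eqP => -[l0 w0]; case: wlast; rewrite l0 w0.
  apply: allpairs_f => //; apply: IH; split=> //; split=> //.
  by case: (w) wlast => [|a w1] []; [left|left|by []|right].
Qed.

(** The right side runs over the same words with [[:: 0]] in place of [[::]]. *)
Lemma big_words (V : zmodType) (F : seq int -> V) n : F [:: 0] = F [::] ->
  \sum_(w <- words n.+1) F w = \sum_(l <- L) \sum_(w <- words n) F (l :: w).
Proof.
move=> F0; pose ext := [seq l :: w | l <- L, w <- words n].
transitivity (\sum_(w <- ext) F w); last by rewrite big_allpairs_dep.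
rewrite [RHS](big_rem [:: 0]) /= ?big_cons ?F0//.
by apply/allpairsP; exists (0, [::]); split=> //; exact: nil_in_words.
Qed.

(** The sum is a supremum over finite subsets, each contained in [words n] for [n] its largest word
    length. *)
Lemma esum_Omega (R : realType) (F : seq int -> R) (m : R) :
  (forall w, 0 <= F w) -> (forall n, \sum_(w <- words n) F w <= m) ->
  (forall eps, 0 < eps -> exists n, m - eps <= \sum_(w <- words n) F w) ->
  (\esum_(w in Omega L) (F w)%:E = m%:E)%E.
Proof.
move=> F0 Fm Fe; apply/eqP; rewrite eq_le; apply/andP; split.
  apply: ge_ereal_sup => _ [A [Afin AO] <-].
  have [s AE] := (finite_seqP A).1 Afin.
  have {}AE : A = [set` undup s] by rewrite AE; apply/seteqP; split => w /=; rewrite mem_undup.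
  rewrite AE -fsbig_seq ?undup_uniq// sumEFin lee_fin.
  apply: le_trans (Fm (\max_(w <- undup s) size w)%N).
  apply: ler_sum_subset => //; first exact: undup_uniq.
  move=> w ws; apply/in_words; split; first by apply: AO; rewrite AE.
  exact: (leq_bigmax_seq w).
apply/lee_subgt0Pr => e e0; have [n hn] := Fe _ e0.
rewrite -EFinB; apply: esum_ge; exists [set` words n].
  by split; [exact: finite_seq|move=> w /in_words[]].
by rewrite -fsbig_seq ?words_uniq// sumEFin lee_fin.
Qed.

End OmegaWords.

(** * Bessel's inequality, the energy of waves, and the vanishing of the defect *)

Section Frame.
Variables (R : realType) (mu : probability R R) (Rs : int) (B L : seq int).
Variable alpha : int -> R[i].
Hypothesis Rs2 : (2 <= `|Rs|)%R.
Hypothesis B_uniq : uniq B.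
Hypothesis B0 : (0 < size B)%N.
Hypothesis mu_inv : forall E, measurable E ->
  (mu E = ((size B)%:R^-1)%:E * \sum_(b <- B) mu (tau Rs b @^-1` E))%E.
Hypothesis L0 : 0 \in L.
Hypothesis alpha0 : alpha 0 = 1.
Hypothesis orth : forall b b', b \in B -> b' \in B ->
  \sum_(l <- L) hadamard_entry Rs (size B) alpha l b
                * conjc (hadamard_entry Rs (size B) alpha l b') = (b == b')%:R.
Implicit Types (f g : R -> R[i]) (t x : R).
Local Notation tau := (@tau R Rs).
Local Notation N := ((size B)%:R : R).

Let RsN0 : Rs%:~R != 0 :> R.
Proof. by rewrite intr_eq0; apply/eqP => Rs0; move: Rs2; rewrite Rs0 normr0. Qed.

Let N_neq0 : N != 0.
Proof. by rewrite pnatr_eq0 -lt0n. Qed.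

(* The adjoint of [f |-> alpha_l e_l (f \o (Rs * _))] on [L^2(mu)]. *)
Definition adj l f x : R[i] :=
  conjc (alpha l) * ((N^-1)%:C%C * \sum_(b <- B) conjc (e_ l (tau b x)) * f (tau b x)).

Definition atom w x : R[i] := word_weight alpha w * e_ (word_freq Rs w) x.

Lemma atom_nil x : atom [::] x = 1.
Proof. by rewrite /atom /word_weight /word_freq big_nil big_ord0 /e_ mul0r cexp2pi0 mulr1. Qed.

Lemma word_freq_cons l w : word_freq Rs (l :: w) = l + Rs * word_freq Rs w.
Proof.
rewrite /word_freq /= big_ord_recl /= expr0 mulr1 mulr_sumr; congr (_ + _).
by apply: eq_bigr => i _; rewrite /= exprS; ring.
Qed.

Lemma atom_cons l w x : atom (l :: w) x = alpha l * e_ l x * atom w (Rs%:~R * x).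
Proof.
rewrite /atom word_freq_cons /word_weight big_cons /e_ intrD intrM mulrDl cexp2piD.
by rewrite (_ : Rs%:~R * _ * x = (word_freq Rs w)%:~R * (Rs%:~R * x)); ring.
Qed.

Lemma cmeasurable_atom w : cmeasurable (atom w).
Proof. by apply: cmeasurableM; [exact: cmeasurable_cst|exact: cmeasurable_wave]. Qed.

(** [Rs * tau b x = x + b], and the integer shift [b] does not affect an integer frequency. *)
Lemma atom_tau w b x : atom w (Rs%:~R * tau b x) = atom w x.
Proof.
rewrite /atom /e_ /Defs.tau [Rs%:~R * _]mulrC divfK// mulrDr -intrM.
by rewrite cexp2piDz.
Qed.

Lemma L2_mul_atom f w : L2 mu f -> L2 mu (fun x => conjc (atom w x) * f x).
Proof.
move=> fL; apply: (@L2M _ _ _ _ (sqnorm (word_weight alpha w))) => //.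
  by apply: cmeasurableJ; exact: cmeasurable_atom.
by move=> x; rewrite sqnormJ /atom sqnormM sqnorm_cexp2pi mulr1.
Qed.

Lemma cinner_atom f w :
  cinner mu f (atom w) = cintegral mu (fun x => conjc (atom w x) * f x).
Proof. by rewrite /cinner; congr cintegral; apply/funext => x; rewrite mulrC. Qed.

Lemma L2_adj l f : L2 mu f -> L2 mu (adj l f).
Proof.
move=> fL; rewrite /adj; apply: L2Z; apply: L2Z.
apply: L2_sum => b bB; apply: (@L2M _ _ _ _ 1); last exact: (L2_tau B0 mu_inv bB fL).
  apply: cmeasurableJ; apply: cmeasurable_comp (@cmeasurable_wave R l%:~R) _.
  exact: measurable_tau.
by move=> x; rewrite sqnormJ sqnorm_cexp2pi.
Qed.

(** Invariance splits the integral along the branches; on each, [atom_cons] detaches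
    [alpha l * e_ l] and [atom_tau] frees the remaining atom from the branch. *)
Lemma cinner_atom_cons f l w : L2 mu f ->
  cinner mu f (atom (l :: w)) = cinner mu (adj l f) (atom w).
Proof.
move=> fL; rewrite !cinner_atom.
rewrite (cintegral_invariant B0 mu_inv); last exact/L2_cintegrable/L2_mul_atom.
have FL b : b \in B ->
    L2 mu (fun x => conjc (atom (l :: w) (tau b x)) * f (tau b x)).
  by move=> bB; exact: (L2_tau B0 mu_inv bB (L2_mul_atom (l :: w) fL)).
rewrite -cintegral_sum// -cintegralZ; last by apply: L2_cintegrable; exact: L2_sum.
congr cintegral; apply/funext => x; rewrite /adj !mulr_sumr.
by apply: eq_bigr => b _; rewrite atom_cons atom_tau !rmorphM /=; ring.
Qed.

(** Up to the unimodular factor [conjc (e_ l (x / Rs))], the values [adj l f x] are the conjugate of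
    the given matrix applied to the vector [f (tau b x) / sqrt N]. *)
Lemma sum_sqnorm_adj f x :
  \sum_(l <- L) sqnorm (adj l f x) = N^-1 * \sum_(b <- B) sqnorm (f (tau b x)).
Proof.
pose M l b := hadamard_entry Rs (size B) alpha l b.
pose v b := ((Num.sqrt N)^-1)%:C%C * f (tau b x).
have sqN : (Num.sqrt N)^-1 * (Num.sqrt N)^-1 = N^-1.
  by rewrite -invrM ?unitfE ?sqrtr_eq0 -?ltNge ?ltr0n// -expr2 sqr_sqrtr.
transitivity (\sum_(l <- L) sqnorm (\sum_(b <- B) conjc (M l b) * v b)).
  apply: eq_bigr => l _.
  have -> : adj l f x = conjc (e_ l (x / Rs%:~R)) * \sum_(b <- B) conjc (M l b) * v b.
    rewrite /adj !mulr_sumr; apply: eq_bigr => b _.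
    have -> : e_ l (tau b x) = e_ l (x / Rs%:~R) * cexp2pi ((l * b)%:~R / Rs%:~R).
      by rewrite /e_ -cexp2piD /Defs.tau; congr cexp2pi; rewrite intrM; field.
    rewrite /M /hadamard_entry /v !conjcM [conjc (Complex _ 0)]conjc_real.
    by rewrite -sqN (rmorphM (real_complex R)); ring.
  by rewrite sqnormM sqnormJ sqnorm_cexp2pi mul1r.
rewrite (sqnorm_sum_conj _ B_uniq orth) mulr_sumr; apply: eq_bigr => b _.
by rewrite /v sqnormM /sqnorm /= expr0n addr0 expr2 sqN.
Qed.

Lemma sum_norm2_adj f : L2 mu f -> \sum_(l <- L) norm2 mu (adj l f) = norm2 mu f.
Proof.
move=> fL; rewrite (norm2_invariant B0 mu_inv fL) /norm2.
have RS (I : eqType) (s : seq I) (g : I -> R -> R[i]) :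
    (forall i, i \in s -> L2 mu (g i)) ->
    \sum_(i <- s) Rintegral mu setT (fun x => sqnorm (g i x)) =
    Rintegral mu setT (fun x => \sum_(i <- s) sqnorm (g i x)) /\
    mu.-integrable setT (EFin \o (fun x => \sum_(i <- s) sqnorm (g i x))).
  elim: s => [|i s IH] gL.
    rewrite big_nil; under [in Rintegral _ _ _]eq_fun do rewrite big_nil.
    under [in integrable _ _ _]eq_fun do rewrite big_nil.
    by split; [rewrite Rintegral_cst//= mul0r|exact: integrable_cst].
  have [|e is_] := IH; first by move=> j js; apply: gL; rewrite in_cons js orbT.
  have iL : L2 mu (g i) by apply: gL; rewrite mem_head.
  rewrite big_cons e -RintegralD//; last exact: L2_integrable.
  have -> : (fun x => \sum_(j <- i :: s) sqnorm (g j x)) =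
      (fun x => sqnorm (g i x) + \sum_(j <- s) sqnorm (g j x)).
    by apply/funext => x; rewrite big_cons.
  by split=> //; exact: (integrableD measurableT (L2_integrable iL) is_).
have [|-> _] := RS _ L (fun l => adj l f); first by move=> l _; exact: L2_adj.
have [|-> iB] := RS _ B (fun b x => f (tau b x)).
  by move=> b bB; exact: (L2_tau B0 mu_inv).
rewrite -RintegralZl//; congr Rintegral; apply/funext => x.
exact: sum_sqnorm_adj.
Qed.

Definition energy n f : R := \sum_(w <- words L n) sqnorm (cinner mu f (atom w)).

(** [big_words] applies because [alpha 0 = 1] gives [[:: 0]] and [[::]] the same atom. *)
Lemma energyS n f : L2 mu f -> energy n.+1 f = \sum_(l <- L) energy n (adj l f).
Proof.
move=> fL; rewrite /energy big_words//.
  by apply: eq_bigr => l _; apply: eq_bigr => w _; rewrite cinner_atom_cons.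
congr (sqnorm (cinner _ _ _)); apply/funext => x.
by rewrite atom_cons alpha0 mul1r /e_ mul0r cexp2pi0 mul1r !atom_nil.
Qed.

Lemma energy0 f : energy 0 f = sqnorm (cintegral mu f).
Proof.
rewrite /energy big_seq1 cinner_atom; congr (sqnorm (cintegral _ _)).
by apply/funext => x; rewrite atom_nil conjc1 mul1r.
Qed.

(** Bessel's inequality by induction: both sides split over the [adj l f], and the empty word is the
    Cauchy-Schwarz bound. *)
Lemma energy_le n f : L2 mu f -> energy n f <= norm2 mu f.
Proof.
elim: n f => [|n IH] f fL; first by rewrite energy0 sqnorm_cintegral_le.
rewrite energyS// -(sum_norm2_adj fL); apply: ler_sum => l _.
by apply: IH; exact: L2_adj.
Qed.

Lemma energy_leS n f : L2 mu f -> energy n f <= energy n.+1 f.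
Proof.
elim: n f => [|n IH] f fL.
  by rewrite /energy big_seq1 big_cons lerDl sumr_ge0// => w _; exact: sqnorm_ge0.
rewrite energyS// [leRHS]energyS//; apply: ler_sum => l _.
by apply: IH; exact: L2_adj.
Qed.

Lemma energy_homo m n f : L2 mu f -> (m <= n)%N -> energy m f <= energy n f.
Proof.
by move=> fL; move: m n; apply/nondecreasing_seqP => n; exact: energy_leS.
Qed.

Lemma cinner_atomD f g w : L2 mu f -> L2 mu g ->
  cinner mu (fun x => f x + g x) (atom w) = cinner mu f (atom w) + cinner mu g (atom w).
Proof.
move=> fL gL; rewrite !cinner_atom -cintegralD; last 2 first.
- by apply: L2_cintegrable; exact: L2_mul_atom.
- by apply: L2_cintegrable; exact: L2_mul_atom.
by congr cintegral; apply/funext => x; rewrite mulrDr.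
Qed.

Lemma cinner_atomZ f c w : L2 mu f ->
  cinner mu (fun x => c * f x) (atom w) = c * cinner mu f (atom w).
Proof.
move=> fL; rewrite !cinner_atom -cintegralZ; last exact/L2_cintegrable/L2_mul_atom.
by congr cintegral; apply/funext => x; rewrite mulrCA.
Qed.

Lemma energy_parallelogram n f g : L2 mu f -> L2 mu g ->
  energy n (fun x => f x + g x) + energy n (fun x => f x - g x) =
  2 * energy n f + 2 * energy n g.
Proof.
move=> fL gL; rewrite /energy -big_split /= !mulr_sumr -big_split /=.
apply: eq_bigr => w _; rewrite cinner_atomD//.
have -> : (fun x => f x - g x) = (fun x => f x + (- 1) * g x).
  by apply/funext => x; rewrite mulN1r.
rewrite cinner_atomD//; last exact: L2Z.
by rewrite cinner_atomZ// mulN1r sqnorm_parallelogram.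
Qed.

Lemma energyZ n f c : L2 mu f -> energy n (fun x => c * f x) = sqnorm c * energy n f.
Proof.
move=> fL; rewrite /energy mulr_sumr; apply: eq_bigr => w _.
by rewrite cinner_atomZ// sqnormM.
Qed.

Definition trans_prob l t : R := sqnorm (alpha l) * sqnorm (mask B (inv_branch Rs l t)).

(** The phase [(t - l) * tau b x] equals [inv_branch l t * (x + b)], so waves go to multiples of
    waves and their energies obey a closed recursion. *)
Lemma adj_wave l t : adj l (wave t) = fun x =>
  conjc (alpha l) * mask B (inv_branch Rs l t) * wave (inv_branch Rs l t) x.
Proof.
apply/funext => x; rewrite /adj /mask -!mulrA; congr (_ * (_ * _)).
rewrite mulr_suml; apply: eq_bigr => b _.
rewrite /e_ conjc_cexp2pi /wave -!cexp2piD; congr cexp2pi.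
by rewrite /inv_branch /Defs.tau; field.
Qed.

(** This is [sum_sqnorm_adj] for a wave, which has modulus 1 everywhere. *)
Lemma sum_trans_prob t : \sum_(l <- L) trans_prob l t = 1.
Proof.
have := sum_sqnorm_adj (wave t) 0.
under [X in X = _ -> _]eq_bigr do rewrite adj_wave !sqnormM sqnormJ sqnorm_wave mulr1.
under [X in _ = _ * X -> _]eq_bigr do rewrite sqnorm_wave.
rewrite big_const_seq count_predT iter_addr addr0 mulVf// => <-.
by apply: eq_bigr => l _; rewrite /trans_prob /mask sqnormM.
Qed.

Let phi t := sqnorm (cintegral mu (wave t)).

Lemma energy_wave n t : energy n (wave t) = transfer_iter Rs L trans_prob phi n t.
Proof.
elim: n t => [|n IH] t; first exact: energy0.
rewrite energyS/=; last exact: L2_wave.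
apply: eq_bigr => l _; rewrite adj_wave energyZ; last exact: L2_wave.
by rewrite IH sqnormM sqnormJ.
Qed.

Hypothesis alpha_neq0 : forall l, l \in L -> alpha l != 0.
Hypothesis Lcond : forall l, l \in L -> l != 0 ->
  zclass Rs B l `&` [set l' | l' \in L]
    <> [set l' | l' \in L /\ (l' == l %[mod Rs])%Z].

Lemma energy_wave_cvg t eps : 0 < eps -> exists n, 1 - eps <= energy n (wave t).
Proof.
move=> eps0.
(* Square modulus of the functional equation of the Fourier transform, read off from [adj 0] on a
   wave. *)
have phi_rec s : phi s = trans_prob 0 s * phi (s / Rs%:~R).
  rewrite /phi (cintegral_invariant B0 mu_inv); last exact/L2_cintegrable/L2_wave.
  rewrite -cintegral_sum; last by move=> b bB; apply: (L2_tau B0 mu_inv bB); exact: L2_wave.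
  rewrite -cintegralZ; last first.
    apply/L2_cintegrable/L2_sum => b bB; apply: (L2_tau B0 mu_inv bB); exact: L2_wave.
  rewrite (_ : (fun x => _) = adj 0 (wave s)).
    rewrite adj_wave cintegralZ; last exact/L2_cintegrable/L2_wave.
    by rewrite /trans_prob !sqnormM sqnormJ /inv_branch subr0.
  apply/funext => x; rewrite /adj alpha0 conjc1 mul1r; congr (_ * _).
  by apply: eq_bigr => b _; rewrite /e_ mul0r cexp2pi0 conjc1 mul1r.
have p_ge0 l s : l \in L -> 0 <= trans_prob l s by move=> _; rewrite mulr_ge0 ?sqnorm_ge0.
have phi_ge0 s : 0 <= phi s := sqnorm_ge0 _.
have phi_le1 s : phi s <= 1.
  by rewrite -(norm2_wave mu s) sqnorm_cintegral_le//; exact: L2_wave.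
have phi0 : phi 0 = 1.
  rewrite /phi (_ : wave 0 = fun=> 1) ?cintegral_cst ?sqnorm1//.
  by apply/funext => x; rewrite /wave mul0r cexp2pi0.
have phi_cont : continuous phi by apply: continuous_sqnorm; exact: ccontinuous_fourier.
have p_cont l : continuous (trans_prob l).
  move=> s; apply: cvgMr.
  apply: (@continuous_comp _ _ _ (inv_branch Rs l) (fun u => sqnorm (mask B u))).
    exact: continuous_inv_branch.
  by apply: continuous_sqnorm; exact: ccontinuous_mask.
(* Elements of [[l]] share the mask value of [l], hence have positive probability too. If all such
   digits were congruent to [l], then [[l]] would meet [L] exactly in the residue class of [l],
   against [Lcond]. *)
have branch s l : l \in L -> l != 0 -> 0 < trans_prob l s ->
    exists l', [/\ l' \in L, 0 < trans_prob l' s & ~~ (Rs %| l' - l)%Z].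
  move=> lL l0 pl; apply: contrapT => nex; apply: (Lcond lL l0).
  apply/seteqP; split => l' /=.
    move=> [zl l'L]; split=> //; rewrite eqz_mod_dvd; apply/negPn/negP => nd.
    apply: nex; exists l'; split=> //.
    suff e : mask B (inv_branch Rs l' s) = mask B (inv_branch Rs l s).
      move: pl; rewrite /trans_prob e !pmulr_rgt0 ?sqnorm_gt0 ?alpha_neq0//.
    rewrite /mask; congr (_ * _); rewrite big_seq [RHS]big_seq; apply: eq_bigr => b bB.
    have /dvdzP[q hq] := zl _ bB.
    rewrite /wave -(cexp2piDz (b%:~R * inv_branch Rs l' s) q); congr cexp2pi.
    have : (l'%:~R - l%:~R) * b%:~R = q%:~R * Rs%:~R :> R by rewrite -intrB -!intrM hq.
    move=> e; apply: (mulIf RsN0); rewrite /inv_branch mulrDl !mulrA !divfK//.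
    by rewrite -e; ring.
  move=> [l'L]; rewrite eqz_mod_dvd => d; split=> // b bB.
  exact: dvdz_mulr.
(* [phi] has no zero near 0, and by [phi_rec] a zero [u] comes from a zero [u / Rs] of [phi] or of
   the mask; the radius doubles at each step. *)
have zeros (K : R) : exists s : seq R, forall t, `|t| <= K -> phi t = 0 -> t \in s.
  have [d d0 hd] : exists2 d, 0 < d & forall u, `|u| < d -> phi u != 0.
    have /cvgrPdist_lt/(_ 1 ltr01) := phi_cont 0.
    rewrite phi0 => -[d /= d0 hd]; exists d => // u ud.
    have : `|1 - phi u| < 1 by apply: hd; rewrite /= sub0r normrN.
    by move=> h; apply/eqP => e; move: h; rewrite e subr0 normr1 ltxx.
  have Rs2R : 2 <= `|Rs%:~R| :> R by rewrite -intr_norm (_ : 2 = 2%:~R)// ler_int.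
  have step k : exists s : seq R, forall t, `|t| < d * 2 ^+ k -> phi t = 0 -> t \in s.
    elim: k => [|k [s hs]].
      exists [::] => u; rewrite expr0 mulr1 => ud e.
      by have := hd _ ud; rewrite e eqxx.
    have [s' hs'] := @finite_mask_zeros R B B0 (d * 2 ^+ k).
    exists (map (fun u => u * Rs%:~R) (s ++ s')) => u ud.
    have uR : `|u / Rs%:~R| < d * 2 ^+ k.
      rewrite normrM normfV ltr_pdivrMr; last by move: Rs2R; lra.
      apply: (lt_le_trans ud); rewrite exprSr mulrA ler_wpM2l//.
      by rewrite mulr_ge0 ?exprn_ge0// ltW.
    rewrite phi_rec => /eqP; rewrite mulf_eq0 /trans_prob alpha0 sqnorm1 mul1r.
    rewrite sqnorm_eq0 /inv_branch subr0 => uz.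
    have us : u / Rs%:~R \in s ++ s'.
      rewrite mem_cat; case/orP: uz => /eqP uz.
        by rewrite (hs' (u / Rs%:~R)) ?orbT// ltW.
      by rewrite (hs (u / Rs%:~R)).
    by apply/mapP; exists (u / Rs%:~R) => //; rewrite divfK.
  have [s hs] := step (Num.truncn (`|K| / d)).+1.
  exists s => u uK; apply: hs; rewrite mulrC -ltr_pdivrMr//.
  apply: (@le_lt_trans _ _ (`|K| / d)).
    by rewrite ler_pM2r ?invr_gt0// (le_trans uK)// ler_norm.
  apply: lt_le_trans (truncnS_gt _) _.
  by rewrite -natrX ler_nat ltnW// ltn_expl.
have [n hn] := @transfer_iter_cvg1 R Rs L trans_prob Rs2 p_ge0 sum_trans_prob phi
  phi_ge0 phi_le1 phi0 phi_cont p_cont L0 phi_rec branch zeros t eps eps0.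
by exists n; rewrite energy_wave.
Qed.

(** The defect obeys the parallelogram law, and that of [f - g] is nonnegative by Bessel's
    inequality. *)
Lemma defectD n f g : L2 mu f -> L2 mu g ->
  norm2 mu (fun x => f x + g x) - energy n (fun x => f x + g x) <=
  2 * (norm2 mu f - energy n f) + 2 * (norm2 mu g - energy n g).
Proof.
move=> fL gL; have := energy_parallelogram n fL gL; have := norm2_parallelogram fL gL.
by have := energy_le n (L2B fL gL); lra.
Qed.

Lemma energy_cvg f eps : L2 mu f -> 0 < eps -> exists n, norm2 mu f - eps <= energy n f.
Proof.
pose V g := L2 mu g /\ forall e, 0 < e -> exists n, norm2 mu g - energy n g <= e.
suff dense g : L2 mu g -> V g.
  by move=> fL /(dense f fL).2[n hn]; exists n; rewrite lerBlDl -lerBlDr.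
have [r mu_tail] := bounded_support B0 mu_inv Rs2.
move: g; apply: (wave_dense mu_tail).
- move=> t; split=> [|e e0]; first exact: L2_wave.
  have [n hn] := energy_wave_cvg t e0; exists n.
  by rewrite norm2_wave; move: hn; lra.
- move=> g1 g2 [L1 V1] [L2' V2]; split=> [|e e0]; first exact: L2D.
  (* [e / 4] absorbs the two factors 2 of [defectD]; defects decrease in [n], so the larger index
     serves both functions. *)
  have e4 : 0 < e / 4 by rewrite divr_gt0.
  have [n1 h1] := V1 _ e4; have [n2 h2] := V2 _ e4; exists (maxn n1 n2).
  have := defectD (maxn n1 n2) L1 L2'.
  have := energy_homo L1 (leq_maxl n1 n2); have := energy_homo L2' (leq_maxr n1 n2).
  by lra.
- move=> c g [Lg Vg]; split=> [|e e0]; first exact: L2Z.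
  (* Adding 1 keeps the divisor positive when [c = 0]. *)
  have c1 : 0 < sqnorm c + 1 by rewrite ltr_wpDl// sqnorm_ge0.
  have [n hn] := Vg _ (divr_gt0 e0 c1); exists n.
  rewrite norm2Z// energyZ// -mulrBr.
  apply: (@le_trans _ _ (sqnorm c * (e / (sqnorm c + 1)))).
    by rewrite ler_wpM2l ?sqnorm_ge0.
  by rewrite mulrCA ler_piMr ?ltW// ltr_pdivrMr// mul1r ltrDl.
(* Write [g = g' + (g - g')]: the defect of the second term is at most its squared norm. *)
- move=> g Lg appr; split=> // e e0.
  have e4 : 0 < e / 4 by rewrite divr_gt0.
  have [g' [Lg' Vg'] gg'] := appr _ e4; have [n hn] := Vg' _ e4; exists n.
  have := defectD n Lg' (L2B Lg Lg').
  have -> : (fun x => g' x + (g x - g' x)) = g by apply/funext => x; rewrite addrC subrK.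
  have : 0 <= energy n (fun x => g x - g' x).
    by rewrite sumr_ge0// => w _; exact: sqnorm_ge0.
  by lra.
Qed.

End Frame.

Unset Implicit Arguments.

Theorem theorem5p3 (R : realType) (Rs : int) (B : seq int) (mu : probability R R)
    (X : set R) (L : seq int) (alpha : int -> R[i]) :
  (2 <= `|Rs|)%R ->
  uniq B -> 0 \in B ->
  (* X = X_B is the attractor: the nonempty compact set with X = U_b tau_b(X) *)
  compact X -> X !=set0 ->
  X = \bigcup_(b in [set b | b \in B]) (tau Rs b @` X) ->
  (* mu = mu(R,B) is the invariant probability measure *)
  (forall E, measurable E ->
     mu E = ((size B)%:R^-1)%:E * \sum_(b <- B) mu (tau Rs b @^-1` E))%E ->
  (* no overlap *)
  (forall b b', b \in B -> b' \in B -> b != b' ->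
     mu (tau Rs b @` X `&` tau Rs b' @` X) = 0%E) ->
  uniq L -> 0 \in L ->
  (forall l, l \in L -> alpha l != 0) -> alpha 0 = 1 ->
  (* the matrix (1/sqrt N)(e^{2 pi i l b / R} alpha_l) has orthonormal columns *)
  (forall b b', b \in B -> b' \in B ->
     \sum_(l <- L) hadamard_entry Rs (size B) alpha l b
                   * conjc (hadamard_entry Rs (size B) alpha l b')
     = (b == b')%:R) ->
  (forall l, l \in L -> l != 0 ->
     zclass Rs B l `&` [set l' | l' \in L]
     <> [set l' | l' \in L /\ (l' == l %[mod Rs])%Z]) ->
  parseval_frame mu (Omega L)
    (fun w x => word_weight alpha w * e_ (word_freq Rs w) x).
Proof.
move=> Rs2 B_uniq B0 _ _ _ mu_inv _ L_uniq L0 alpha_neq0 alpha0 orth Lcond f fL.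
have B_gt0 : (0 < size B)%N by case: (B) B0.
rewrite (norm2E fL); apply: (esum_Omega L_uniq).
- by move=> w; exact: sqnorm_ge0.
- by move=> n; exact: (energy_le Rs2 B_uniq B_gt0 mu_inv L0 alpha0 orth n fL).
- move=> eps eps0.
  exact: (energy_cvg Rs2 B_uniq B_gt0 mu_inv L0 alpha0 orth alpha_neq0 Lcond fL eps0).
Qed.
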